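(* Let $\mathcal{P}$ be a finite-horizon POMDP, let $\tilde{\mathcal{M}} = \langle \tilde{\mathcal{S}}, \mathcal{A}, \{\tilde P_t\}_{t=1}^{T-1}, \{\tilde c_t\}_{t=1}^T, T\rangle$ be the abstract MDP built from a state abstraction function $\phi\colon \mathcal{S}\to\tilde{\mathcal{S}}$ and kernels $\lambda^P,\lambda^c$, and let $\{\mathcal{E}_t\}_{t=1}^T$, $\mathcal{E}_t \colon \mathcal{H}_t \to \tilde{\mathcal{S}}$, be abstract state estimation functions (all as in the context). Assume: (i) $\tilde{\mathcal{M}}$ satisfies measurable selection; (ii) there are concave and non-decreasing functions $F^P_t, F^c_t \colon \mathbb{R}_{\ge 0} \to \mathbb{R}_{\ge 0}$ such that for all $s, s' \in \mathcal{S}$ and $a \in \mathcal{A}$, $$d_{\mathrm{Was}}(P^{\phi}_{S,t}(\cdot | s, a), P^{\phi}_{S,t}(\cdot | s', a)) \le F^P_t(d_{\tilde{\mathcal{S}}}(\phi(s), \phi(s'))) \quad (t \in \{1,\dots,T-1\}),$$ $$| c_t(s,a) - c_t(s',a) | \le F^c_t(d_{\tilde{\mathcal{S}}}(\phi(s), \phi(s'))) \quad (t \in \{1,\dots,T\});$$ (iii) for every $t \in \{1, \dots, T\}$, $\eta_t := \sup_{h_t \in \mathcal{H}_t} \mathbb{E}[ d_{\tilde{\mathcal{S}}}(\phi(S_t), \mathcal{E}_t(h_t)) \mid h_t ] < \infty$. Define $\varepsilon_t = F^c_t(\eta_t)$ for $t \in \{1,\dots,T\}$ and $\delta_t = F^P_t(\eta_t)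 + \eta_{t+1}$ for $t \in \{1,\dots,T-1\}$. Let $\pi^{\tilde{\mathcal{M}}}$ be an optimal policy of $\tilde{\mathcal{M}}$, let $\{V^{\tilde{\mathcal{M}}}_t\}_{t=1}^T$ be the optimal value functions of $\tilde{\mathcal{M}}$, and let $\mu^{\mathcal{E}} = (\mu^{\mathcal{E}}_1,\dots,\mu^{\mathcal{E}}_T)$ be the certainty equivalent policy $\mu^{\mathcal{E}}_t(h_t) = \pi^{\tilde{\mathcal{M}}}_t(\mathcal{E}_t(h_t))$. Then for every $t \in \{1,\dots,T\}$ and $h_t \in \mathcal{H}_t$, $$W^{\mathcal{P}, \mu^{\mathcal{E}}}_t(h_t) - W^{\mathcal{P}}_t(h_t) \le 2 \alpha_t, \qquad \text{where } \alpha_t = \varepsilon_t + \sum_{\tau = t}^{T-1}\bigl[ \delta_{\tau}\,\mathrm{Lip}(V^{\tilde{\mathcal{M}}}_{\tau+1}) + \varepsilon_{\tau+1} \bigr].$$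
   Context: POMDP $\mathcal{P}$: horizon $T$; state, observation and action spaces $\mathcal{S}, \mathcal{Y}, \mathcal{A}$ are metric spaces that are Borel spaces. The initial pair $(S_1, Y_1)$ has law $\xi \in \Delta(\mathcal{S} \times \mathcal{Y})$, where $\Delta(\mathcal X)$ denotes the probability measures on $\mathcal X$. For $t \in \{1,\dots,T-1\}$ there is a stochastic kernel $P_t \colon \mathcal{S} \times \mathcal{A} \to \Delta(\mathcal{S} \times \mathcal{Y})$ with $\mathbb{P}(S_{t+1} \in M_S, Y_{t+1} \in M_Y \mid s_{1:t}, y_{1:t}, a_{1:t}) = P_t(M_S, M_Y \mid s_t, a_t)$. $P_{S,t}(\cdot|s,a)$ is its marginal on $\mathcal{S}$. The per-step costs $c_t \colon \mathcal{S} \times \mathcal{A} \to \mathbb{R}$, $t\in\{1,\dots,T\}$, are measurable and uniformly bounded: $\sup_{s,a}|c_t(s,a)| \le c_{\max}$. All policies, estimators and functions are measurable. Histories and beliefs: $h_t = (y_{1:t}, a_{1:t-1}) \in \mathcal{H}_t$. $b_{t|t}(\cdot|h_t)$ is the posterior law of $S_t$ given $h_t$; it does not depend on the policy. Concretely, $b_{1|1}(\cdot|y_1)$ disintegrates $\xi$ with respect to $y_1$; $b_{t+1|t}(M_S, M_Y|h_t,a_t) = \int_{\mathcal{S}} P_t(M_S,M_Y|s,a_t)\, b_{t|t}(ds|h_t)$; and $b_{t+1|t+1}(\cdot|h_t,a_t,y_{t+1})$ disintegrates $b_{t+1|t}(\cdot,\cdot|h_t,a_t)$ with respect to $y_{t+1}$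 (a version of these kernels is fixed). $\mathbb{E}[f(S_t)|h_t]$ denotes $\int f\,db_{t|t}(\cdot|h_t)$, and conditional expectations of future quantities given $h_t$ under a policy are computed by starting from $S_t \sim b_{t|t}(\cdot|h_t)$ and evolving forward with the kernels $P_\tau$ and the policy. Values in $\mathcal{P}$: for a deterministic history-dependent policy $\mu = (\mu_1,\dots,\mu_T)$, $\mu_t\colon \mathcal{H}_t \to \mathcal{A}$, $W^{\mathcal{P},\mu}_t(h_t) = \mathbb{E}^{\mu}[\sum_{\tau=t}^T c_\tau(S_\tau, A_\tau) \mid h_t]$, and $W^{\mathcal{P}}_t(h_t) = \inf_\mu W^{\mathcal{P},\mu}_t(h_t)$ over all history-dependent policies. State abstraction: $\tilde{\mathcal{S}}$ is a (Borel) space with metric $d_{\tilde{\mathcal{S}}}$; $\phi\colon\mathcal{S}\to\tilde{\mathcal{S}}$ is measurable; $\lambda^P, \lambda^c\colon \tilde{\mathcal{S}} \to \Delta(\mathcal{S})$ are stochastic kernels with $\lambda^P(\phi^{-1}(\tilde s)|\tilde s) = \lambda^c(\phi^{-1}(\tilde s)|\tilde s) = 1$ for each $\tilde s\in\tilde{\mathcal{S}}$. $P^\phi_{S,t}\colon \mathcal{S}\times\mathcal{A}\to\Delta(\tilde{\mathcal{S}})$ is the law of the next abstract state: $P^\phi_{S,t}(M|s,a) = P_{S,t}(\phi^{-1}(M)|s,a)$ for Borel $M\subset\tilde{\mathcal{S}}$. The abstract MDP $\tilde{\mathcal{M}}$ has state space $\tilde{\mathcal{S}}$, action space $\mathcal{A}$,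 dynamics $\tilde P_t(M|\tilde s,a) = \int_{\phi^{-1}(\tilde s)} P^\phi_{S,t}(M|s,a)\,\lambda^P(ds|\tilde s)$ and cost $\tilde c_t(\tilde s,a) = \int_{\phi^{-1}(\tilde s)} c_t(s,a)\,\lambda^c(ds|\tilde s)$. Measurable selection: $\tilde{\mathcal{M}}$ satisfies measurable selection if for every measurable $V\colon \tilde{\mathcal{S}}\to\mathbb{R}$ (for which the integrals below are well defined) and each $t$ there is a measurable $\pi\colon \tilde{\mathcal{S}} \to \mathcal{A}$ such that for all $\tilde s$, $\inf_{a \in \mathcal{A}} \{ \tilde c_t(\tilde s,a) + \int V(s') \tilde P_t(ds'|\tilde s,a) \} = \tilde c_t(\tilde s,\pi(\tilde s)) + \int V(s') \tilde P_t(ds'|\tilde s,\pi(\tilde s)) =: V_+(\tilde s)$, and $V_+\colon\tilde{\mathcal{S}}\to\mathbb{R}$ is measurable (at $t=T$ the integral term is absent). Optimal value functions and policy of $\tilde{\mathcal{M}}$: $V^{\tilde{\mathcal{M}}}_{T+1} = 0$ and $V^{\tilde{\mathcal{M}}}_t(\tilde s) = \min_{a}\{\tilde c_t(\tilde s,a) + \int V^{\tilde{\mathcal{M}}}_{t+1}(s') \tilde P_t(ds'|\tilde s,a)\}$ for $t = T,\dots,1$ (no integral term at $t=T$); an optimal policy $\pi^{\tilde{\mathcal{M}}}=(\pi_1^{\tilde{\mathcal M}},\dots,\pi_T^{\tilde{\mathcal M}})$ consists of measurable maps $\pi^{\tilde{\mathcal{M}}}_t\colon \tilde{\mathcal{S}}\to\mathcal{A}$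 attaining these minima at every $\tilde s$ and $t$. $d_{\mathrm{Was}}(\nu_1,\nu_2) = \inf \mathbb{E}[d_{\tilde{\mathcal{S}}}(S_1,S_2)]$ over all couplings of $\nu_1, \nu_2\in\Delta(\tilde{\mathcal{S}})$. $\mathrm{Lip}(f)$ is the Lipschitz constant of $f$ (with respect to $d_{\tilde{\mathcal{S}}}$ on the domain). *)

(* Defs.v *)
From HB Require Import structures.
From mathcomp Require Import all_boot all_order all_algebra.
From mathcomp Require Import all_classical all_reals all_analysis.
From mathcomp Require Import measurable_realfun.

Set Implicit Arguments.
Unset Strict Implicit.
Unset Printing Implicit Defensive.
Import Order.TTheory GRing.Theory Num.Theory.
Import numFieldNormedType.Exports.

Local Open Scope classical_set_scope.
Local Open Scope ring_scope.

(* Metric Borel spaces: the sigma-algebra is the one generated by the open sets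
   of the metric, and the space is homeomorphic to a Borel subset of a Polish
   space. *)
HB.mixin Record isBorelSpace (R : realType) d X
    & Measurable d X & Metric R X := {
  borel_measurableE : (@measurable d X) = <<s @open X >> ;
  borel_polish : exists (P : completePseudoMetricType R) (f : X -> P),
    [/\ hausdorff_space P,
        (exists2 D : set P, countable D & dense D),
        injective f,
        (forall U : set X, open U <-> exists2 V : set P, open V & U = f @^-1` V)
      & <<s @open P >> (range f)] }.

#[short(type="borelSpaceType")]
HB.structure Definition BorelSpace (R : realType) d :=
  { X of Measurable d X & Metric R X & isBorelSpace R d X }.

Lemma borel_measurable_set1 (R : realType) d (X : borelSpaceType R d) (x : X) :
  measurable [set x].
Proof.
rewrite -[[set x]]setCK; apply: measurableC; rewrite borel_measurableE.
apply: sub_sigma_algebra; apply: closed_openC.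
apply: accessible_closed_set1; apply: hausdorff_accessible.
exact: metric_hausdorff.
Qed.

Lemma measurable_rcons d1 d2 (X : measurableType d1) (Y : measurableType d2) n
    (f : X -> n.-tuple Y) (g : X -> Y) :
  measurable_fun [set: X] f -> measurable_fun [set: X] g ->
  measurable_fun [set: X] (fun x => [tuple of rcons (f x) (g x)]).
Proof.
move=> mf mg; apply/measurable_fun_tnthP => i.
have [ni|ni] := ltnP i n.
  rewrite (_ : _ \o _ = (fun x => tnth (f x) (Ordinal ni))).
    apply: (measurableT_comp (f := fun t : n.-tuple Y => tnth t _)) => //.
    exact: measurable_tnth.
  apply/funext => x /=; rewrite !(tnth_nth point)/= nth_rcons size_tuple ni.
  by [].
rewrite (_ : _ \o _ = g)//; apply/funext => x /=.
rewrite (tnth_nth point)/= nth_rcons size_tuple ltnNge ni/=.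
by rewrite eqn_leq ni -ltnS ltn_ord.
Qed.

Section kernel_transport.
Local Open Scope ereal_scope.
Context d1 d2 d3 (X : measurableType d1) (Y : measurableType d2)
  (Z : measurableType d3) (R : realType).

Section precomposition.
Variables (k : R.-pker Y ~> Z) (f : X -> Y).

Definition kpre (mf : measurable_fun [set: X] f) (x : X) :
  {measure set Z -> \bar R} := k (f x).

Hypothesis mf : measurable_fun [set: X] f.

Let measurable_kpre U :
  measurable U -> measurable_fun [set: X] (kpre mf ^~ U).
Proof.
move=> mU; apply: (measurableT_comp (f := k ^~ U)) => //.
exact: measurable_kernel.
Qed.

HB.instance Definition _ := isKernel.Build _ _ X Z R (kpre mf) measurable_kpre.

Let kpre_prob x : kpre mf x [set: Z] = 1.
Proof. exact: prob_kernel. Qed.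

HB.instance Definition _ :=
  Kernel_isProbability.Build _ _ X Z R (kpre mf) kpre_prob.

End precomposition.

Section pushforward.
Variables (k : R.-pker X ~> Y) (f : Y -> Z).

Definition kpush (mf : measurable_fun [set: Y] f) (x : X) :
  set Z -> \bar R := pushforward (k x) f.

Hypothesis mf : measurable_fun [set: Y] f.

HB.instance Definition _ x := Measure.copy (kpush mf x)
  (measure_function_pushforward__canonical__measure_function_Measure (k x) mf).

Definition mkpush : X -> {measure set Z -> \bar R} := kpush mf.

Let measurable_kpush U :
  measurable U -> measurable_fun [set: X] (mkpush ^~ U).
Proof.
move=> mU; apply: measurable_kernel.
by rewrite -[X in measurable X]setTI; exact: mf.
Qed.

HB.instance Definition _ :=
  isKernel.Build _ _ X Z R mkpush measurable_kpush.

Let kpush_prob x : mkpush x [set: Z] = 1.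
Proof. rewrite /mkpush/= /kpush /pushforward preimage_setT; exact: prob_kernel. Qed.

HB.instance Definition _ :=
  Kernel_isProbability.Build _ _ X Z R mkpush kpush_prob.

End pushforward.

End kernel_transport.

Section fiber_average.
Local Open Scope ereal_scope.
Context d1 d2 d3 d4 (X : measurableType d1) (S : measurableType d2)
  (A : measurableType d3) (Z : measurableType d4) (R : realType).
Variables (lam : R.-pker X ~> S) (phi : S -> X).
Hypothesis mphi : forall x, measurable (phi @^-1` [set x]).
Hypothesis lam1 : forall x, lam x (phi @^-1` [set x]) = 1.

Lemma fiber_integralE x (f : S -> \bar R) :
    measurable_fun [set: S] f -> (forall s, 0 <= f s) ->
  \int[lam x]_(s in phi @^-1` [set x]) f s = \int[lam x]_s f s.
Proof.
move=> mf f0; rewrite [RHS](@ge0_negligible_integral _ _ _ _ setT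
  (~` (phi @^-1` [set x])))//.
- by rewrite setTD setCK.
- exact: measurableC.
- have lamT : lam x [set: S] = 1 by exact: prob_kernel.
  rewrite -setTD measureD//; last by rewrite [ltLHS]lamT ltry.
  by rewrite setTI [X in X - _]lamT [X in _ - X]lam1 subee.
Qed.


Lemma measurable_fun_fiber_integral (f : S * A -> \bar R) :
    measurable_fun [set: S * A] f -> (forall z, 0 <= f z) ->
  measurable_fun [set: X * A] (fun xa =>
    \int[lam xa.1]_(s in phi @^-1` [set xa.1]) f (s, xa.2)).
Proof.
move=> mf f0.
have mg : measurable_fun [set: (X * A) * S] (fun z => (z.2, z.1.2)).
  by apply: measurable_fun_pair => //; exact: measurableT_comp.
pose g (z : (X * A) * S) := f (z.2, z.1.2).
rewrite [X in measurable_fun _ X](_ : _ =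
    (fun xa => \int[kpre lam measurable_fst xa]_s g (xa, s))).
  apply: measurable_fun_integral_finite_kernel.
    by move=> z; exact: f0.
  exact: (measurableT_comp mf mg).
apply/funext => xa; rewrite fiber_integralE//.
by apply: measurableT_comp => //; exact: pair2_measurable.
Qed.

Section kernel.
Variable k : R.-pker (S * A) ~> Z.

Definition fiber_kernel (xa : X * A) (U : set Z) : \bar R :=
  \int[lam xa.1]_(s in phi @^-1` [set xa.1]) k (s, xa.2) U.

Let fiber_kernel0 xa : fiber_kernel xa set0 = 0.
Proof. by rewrite /fiber_kernel integral0_eq// => s _; rewrite measure0. Qed.

Let fiber_kernel_ge0 xa U : 0 <= fiber_kernel xa U.
Proof. exact: integral_ge0. Qed.

Let measurable_kA a U : measurable U -> measurable_fun [set: S]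
  (fun s => k (s, a) U).
Proof.
move=> mU; apply: (measurableT_comp (f := k ^~ U)).
  exact: measurable_kernel.
exact: pair2_measurable.
Qed.

Let fiber_kernel_sigma_additive xa : semi_sigma_additive (fiber_kernel xa).
Proof.
move=> U mU tU mUU; rewrite [X in _ --> X](_ : _ =
  \int[lam xa.1]_(s in phi @^-1` [set xa.1])
    (\sum_(n <oo) k (s, xa.2) (U n))); last first.
  apply: eq_integral => s _.
  by apply/esym/cvg_lim => //; exact/measure_semi_sigma_additive.
apply/cvg_closeP; split.
  by apply: is_cvg_nneseries => n _ _; exact: integral_ge0.
rewrite closeE// integral_nneseries// => n.
by apply: measurable_funTS; exact: measurable_kA.
Qed.

HB.instance Definition _ xa := isMeasure.Build _ _ R (fiber_kernel xa)
  (fiber_kernel0 xa) (fiber_kernel_ge0 xa) (@fiber_kernel_sigma_additive xa).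

(* the proof that lam x is carried by the fiber over x is an argument, so that
   the instances below can be inferred *)
Definition mkfiber of (forall x, lam x (phi @^-1` [set x]) = 1) :
  X * A -> {measure set Z -> \bar R} := fiber_kernel.

Let measurable_mkfiber U :
  measurable U -> measurable_fun [set: X * A] (mkfiber lam1 ^~ U).
Proof.
move=> mU; apply: (@measurable_fun_fiber_integral (k ^~ U)) => //.
exact: measurable_kernel.
Qed.

HB.instance Definition _ :=
  isKernel.Build _ _ (X * A)%type Z R (mkfiber lam1)
  measurable_mkfiber.

Let mkfiber_prob xa : mkfiber lam1 xa [set: Z] = 1.
Proof.
rewrite /mkfiber /= /fiber_kernel.
rewrite (eq_integral (fun=> 1)) => [|s _]; last exact: prob_kernel.
by rewrite integral_cst// mul1e; exact: lam1.
Qed.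

HB.instance Definition _ :=
  Kernel_isProbability.Build _ _ (X * A)%type Z R (mkfiber lam1)
  mkfiber_prob.

End kernel.

Definition fiber_fun (c : S * A -> R) (xa : X * A) : R :=
  (\int[lam xa.1]_(s in phi @^-1` [set xa.1]) c (s, xa.2))%R.

Lemma measurable_fiber_fun c : measurable_fun [set: S * A] c ->
  measurable_fun [set: X * A] (fiber_fun c).
Proof.
move=> mc; have mc' : measurable_fun [set: S * A] (EFin \o c).
  exact/measurable_EFinP.
rewrite /fiber_fun /Rintegral.
apply: (measurableT_comp (f := fine)) => //.
under eq_fun do rewrite integralE.
apply: emeasurable_funB.
- under eq_fun do under eq_integral do rewrite funeposE.
  apply: (@measurable_fun_fiber_integral (fun z => maxe (c z)%:E 0)).
    by apply: measurable_maxe => //; exact: measurable_cst.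
  by move=> z; rewrite le_max lexx orbT.
- under eq_fun do under eq_integral do rewrite funenegE.
  apply: (@measurable_fun_fiber_integral (fun z => maxe (- (c z)%:E) 0)).
    apply: measurable_maxe; last exact: measurable_cst.
    exact: measurableT_comp mc'.
  by move=> z; rewrite le_max lexx orbT.
Qed.

End fiber_average.

Section kernel_bind.
Local Open Scope ereal_scope.
Context d1 d2 d3 (X : measurableType d1) (Y : measurableType d2)
  (Z : measurableType d3) (R : realType).
Variables (l : R.-pker X ~> Y) (k : R.-pker (X * Y) ~> Z).

(* mkcomp, registered as a probability kernel *)
Definition kbind : X -> {measure set Z -> \bar R} := mkcomp l k.

Let measurable_kbind U :
  measurable U -> measurable_fun [set: X] (kbind ^~ U).
Proof. by move=> mU; exact: (measurable_fun_mkcomp_sfinite l k). Qed.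

HB.instance Definition _ := isKernel.Build _ _ X Z R kbind measurable_kbind.

Let kbind_prob x : kbind x [set: Z] = 1.
Proof.
rewrite /kbind /mkcomp/= /kcomp.
rewrite (eq_integral (fun=> 1)) => [|y _]; last exact: prob_kernel.
by rewrite integral_cst// mul1e; exact: prob_kernel.
Qed.

HB.instance Definition _ :=
  Kernel_isProbability.Build _ _ X Z R kbind kbind_prob.

End kernel_bind.

(* Times are numbered from 0: index n stands for time n + 1, so the history
   h_(n+1) = (y_1, ..., y_(n+1), a_1, ..., a_n) lives in hist n. *)
Section histories.
Context (R : realType) dY dA (Y : borelSpaceType R dY)
  (A : borelSpaceType R dA).

Definition hist n : measurableType _ := (n.+1.-tuple Y * n.-tuple A)%type.

Definition hist0 (y : Y) : hist 0 := ([tuple y], [tuple]).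

Definition hnext n (h : hist n) (a : A) (y : Y) : hist n.+1 :=
  ([tuple of rcons h.1 y], [tuple of rcons h.2 a]).

Definition policy := forall n, {mfun hist n >-> A}.

Lemma measurable_hnext d (X : measurableType d) n (h : X -> hist n)
    (a : X -> A) (y : X -> Y) :
  measurable_fun [set: X] h -> measurable_fun [set: X] a ->
  measurable_fun [set: X] y ->
  measurable_fun [set: X] (fun x => hnext (h x) (a x) (y x)).
Proof.
move=> mh ma my; apply: measurable_fun_pair; apply: measurable_rcons => //.
  exact: (measurableT_comp measurable_fst mh).
exact: (measurableT_comp measurable_snd mh).
Qed.

End histories.
Arguments hist {R dY dA} Y A n.
Arguments hist0 {R dY dA Y} A y.
Arguments policy {R dY dA} Y A.

(* Only trans n for n + 1 < horizon and cost n for n < horizon are part of the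
   model; the other members of the two families are irrelevant. *)
Record pomdp (R : realType) dS dY dA (S : borelSpaceType R dS)
    (Y : borelSpaceType R dY) (A : borelSpaceType R dA) := Pomdp {
  horizon : nat ;
  init : probability (S * Y)%type R ;
  trans : nat -> R.-pker (S * A) ~> (S * Y)%type ;
  cost : nat -> {mfun (S * A)%type >-> R} ;
  cost_bounded : exists cmax : R,
    forall n, (n < horizon)%N -> forall s a, `|cost n (s, a)| <= cmax
}.

Section beliefs.
Local Open Scope ereal_scope.
Context (R : realType) dS dY dA (S : borelSpaceType R dS)
  (Y : borelSpaceType R dY) (A : borelSpaceType R dA) (P : pomdp S Y A).

Definition disintegrates (m : {measure set (S * Y) -> \bar R})
    (k : Y -> {measure set S -> \bar R}) :=
  forall (MS : set S) (MY : set Y), measurable MS -> measurable MY ->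
    m (MS `*` MY) = \int[pushforward m snd]_(y in MY) k y MS.

Lemma measurable_pred_arg n : measurable_fun [set: (hist Y A n * A) * S]
  (fun z => (z.2, z.1.2) : S * A).
Proof.
by apply: measurable_fun_pair => //; exact: measurableT_comp.
Qed.

(* the joint law of the next state and observation given (h, a), when the
   current state has law b h *)
Definition predict n (b : R.-pker (hist Y A n) ~> S) :
    R.-pker (hist Y A n * A) ~> (S * Y)%type :=
  kbind (kpre b measurable_fst) (kpre (trans P n) (@measurable_pred_arg n)).

Record belief := Belief {
  bel : forall n, R.-pker (hist Y A n) ~> S ;
  bel_init : disintegrates (init P) (fun y => bel 0 (hist0 A y)) ;
  bel_next : forall n, (n.+1 < horizon P)%N -> forall h a,
    disintegrates (predict (bel n) (h, a)) (fun y => bel n.+1 (hnext h a y))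
}.

End beliefs.

Section policy_values.
Local Open Scope ereal_scope.
Context (R : realType) dS dY dA (S : borelSpaceType R dS)
  (Y : borelSpaceType R dY) (A : borelSpaceType R dA) (P : pomdp S Y A)
  (b : belief P) (mu : policy Y A).

Definition act n (sh : S * hist Y A n) : S * A := (sh.1, mu n sh.2).

Lemma measurable_act n : measurable_fun [set: S * hist Y A n] (@act n).
Proof. by apply: measurable_fun_pair => //; exact: measurableT_comp. Qed.

Definition act_next n (z : (S * hist Y A n) * (S * Y)) : S * hist Y A n.+1 :=
  (z.2.1, hnext z.1.2 (mu n z.1.2) z.2.2).

Lemma measurable_act_next n :
  measurable_fun [set: (S * hist Y A n) * (S * Y)] (@act_next n).
Proof.
apply: measurable_fun_pair; first exact: measurableT_comp.
apply: measurable_hnext; [|apply: measurableT_comp => //|];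
  exact: measurableT_comp.
Qed.

Definition act1 n (sh : S * hist Y A n) : 1.-tuple (S * A) :=
  [tuple act sh].

Lemma measurable_act1 n : measurable_fun [set: S * hist Y A n] (@act1 n).
Proof.
apply: (measurable_cons (g := fun=> [tuple])); last exact: measurable_cst.
exact: measurable_act.
Qed.

Definition act_cons n k (z : (S * hist Y A n) * k.-tuple (S * A)) :
  k.+1.-tuple (S * A) := [tuple of act z.1 :: z.2].

Lemma measurable_act_cons n k :
  measurable_fun [set: (S * hist Y A n) * k.-tuple (S * A)] (@act_cons n k).
Proof.
apply: measurable_cons => //; apply: measurableT_comp => //.
exact: measurable_act.
Qed.

(* traj k n (s, h): the law of the state-action pairs at times n, ..., n + k
   when the state at time n is s, the history at time n is h, and the system
   evolves with the transition kernels under mu *)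
Fixpoint traj k n : R.-pker (S * hist Y A n) ~> k.+1.-tuple (S * A)%type :=
  match k with
  | 0 => kdirac (@measurable_act1 n)
  | k'.+1 =>
      kbind (kbind (kpre (trans P n) (@measurable_act n))
                   (kpre (traj k' n.+1) (@measurable_act_next n)))
            (kdirac (@measurable_act_cons n k'.+1))
  end.

Lemma measurable_swap_hist n :
  measurable_fun [set: hist Y A n * S] (fun z => (z.2, z.1) : S * hist Y A n).
Proof. exact: measurable_fun_pair. Qed.

(* the conditional law, given the history h at time n, of the state-action
   pairs from time n on, k + 1 of them *)
Definition traj_given k n : R.-pker (hist Y A n) ~> k.+1.-tuple (S * A)%type :=
  kbind (bel b n) (kpre (traj k n) (@measurable_swap_hist n)).

(* For n < horizon the sum has horizon - n terms. *)
Definition policy_value n (h : hist Y A n) : \bar R :=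
  let k := (horizon P - n).-1 in
  \int[traj_given k n h]_w
    (\sum_(j < k.+1) cost P (n + j) (tnth w j))%R%:E.

End policy_values.

Definition optimal_value (R : realType) dS dY dA (S : borelSpaceType R dS)
    (Y : borelSpaceType R dY) (A : borelSpaceType R dA) (P : pomdp S Y A)
    (b : belief P) n (h : hist Y A n) : \bar R :=
  ereal_inf [set policy_value b mu h | mu in [set: policy Y A]].

Record mdp (R : realType) dX dA (X : borelSpaceType R dX)
    (A : borelSpaceType R dA) := Mdp {
  mdp_horizon : nat ;
  mdp_trans : nat -> R.-pker (X * A) ~> X ;
  mdp_cost : nat -> {mfun (X * A)%type >-> R}
}.

Section mdp_theory.
Local Open Scope ereal_scope.
Context (R : realType) dX dA (X : borelSpaceType R dX)
  (A : borelSpaceType R dA) (M : mdp X A).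

Definition qvalue n (V : X -> R) (x : X) (a : A) : \bar R :=
  (mdp_cost M n (x, a))%:E +
  (if (n.+1 < mdp_horizon M)%N then \int[mdp_trans M n (x, a)]_x' (V x')%:E
   else 0).

Definition bellman n (V : X -> R) (x : X) : \bar R :=
  ereal_inf [set qvalue n V x a | a in [set: A]].

Definition measurable_selection :=
  forall n (V : {mfun X >-> R}), (n < mdp_horizon M)%N ->
    ((n.+1 < mdp_horizon M)%N -> forall x a,
       (mdp_trans M n (x, a)).-integrable [set: X] (EFin \o V)) ->
  exists pi : {mfun X >-> A},
    (forall x, bellman n V x = qvalue n V x (pi x)) /\
    measurable_fun [set: X] (fun x => qvalue n V x (pi x)).

Fixpoint value_rec k n (x : X) : R :=
  if k is k'.+1 then fine (bellman n (value_rec k' n.+1) x) else 0%R.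

(* In particular mdp_value n = 0 for n >= mdp_horizon M. *)
Definition mdp_value n : X -> R := value_rec (mdp_horizon M - n) n.

Definition optimal_policy (pi : nat -> {mfun X >-> A}) :=
  forall n, (n < mdp_horizon M)%N -> forall x,
    qvalue n (mdp_value n.+1) x (pi n x) = bellman n (mdp_value n.+1) x.

End mdp_theory.

Record abstraction (R : realType) dS dX (S : borelSpaceType R dS)
    (X : borelSpaceType R dX) := Abstraction {
  phi : {mfun S >-> X} ;
  lamP : R.-pker X ~> S ;
  lamc : R.-pker X ~> S ;
  lamP_fiber : forall x, lamP x (phi @^-1` [set x]) = 1%E ;
  lamc_fiber : forall x, lamc x (phi @^-1` [set x]) = 1%E
}.

Section abstract_mdp.
Local Open Scope ereal_scope.
Context (R : realType) dS dY dA dX (S : borelSpaceType R dS)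
  (Y : borelSpaceType R dY) (A : borelSpaceType R dA)
  (X : borelSpaceType R dX) (P : pomdp S Y A) (abs : abstraction S X).

Definition trans_state n : R.-pker (S * A) ~> S :=
  mkpush (trans P n) measurable_fst.

Definition trans_abs n : R.-pker (S * A) ~> X :=
  mkpush (trans_state n) (measurable_funPT (phi abs)).

Lemma measurable_fiber x : measurable (phi abs @^-1` [set x]).
Proof.
rewrite -[X in measurable X]setTI.
by apply: (measurable_funPT (phi abs)) => //; exact: borel_measurable_set1.
Qed.

Definition abs_trans n : R.-pker (X * A) ~> X :=
  mkfiber measurable_fiber (trans_abs n) (@lamP_fiber _ _ _ _ _ abs).

Definition abs_cost n (xa : X * A) : R :=
  fiber_fun (lamc abs) (phi abs) (cost P n) xa.

Let measurable_abs_cost n : measurable_fun [set: X * A] (abs_cost n).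
Proof.
apply: (measurable_fiber_fun measurable_fiber (@lamc_fiber _ _ _ _ _ abs)).
exact: measurable_funPT.
Qed.

HB.instance Definition _ n := isMeasurableFun.Build _ _ _ _ (abs_cost n)
  (measurable_abs_cost n).

Definition abstract_mdp : mdp X A := Mdp (horizon P) abs_trans abs_cost.

End abstract_mdp.

Definition wasserstein (R : realType) dX (X : borelSpaceType R dX)
    (m1 m2 : {measure set X -> \bar R}) : \bar R :=
  ereal_inf [set (\int[g]_z (mdist z.1 z.2)%:E)%E |
    g in [set g : probability (X * X)%type R |
      forall U, measurable U ->
        g (U `*` setT) = m1 U /\ g (setT `*` U) = m2 U]].

(* +oo when f is not Lipschitz *)
Definition Lip (R : realType) dX (X : borelSpaceType R dX) (f : X -> R) :
    \bar R :=
  ereal_inf [set L%:E | L in [set L : R | 0 <= L /\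
    forall x y, `|f x - f y| <= L * mdist x y]].

Definition concave_nondecreasing (R : realType) (F : R -> R) :=
  [/\ forall x, 0 <= x -> 0 <= F x,
      forall x y, 0 <= x -> x <= y -> F x <= F y
    & forall x y t, 0 <= x -> 0 <= y -> 0 <= t -> t <= 1 ->
        t * F x + (1 - t) * F y <= F (t * x + (1 - t) * y)].

Section certainty_equivalence.
Local Open Scope ereal_scope.
Context (R : realType) dS dY dA dX (S : borelSpaceType R dS)
  (Y : borelSpaceType R dY) (A : borelSpaceType R dA)
  (X : borelSpaceType R dX) (P : pomdp S Y A) (b : belief P)
  (abs : abstraction S X) (E : forall n, {mfun hist Y A n >-> X}).

Definition est_error n : \bar R :=
  ereal_sup [set \int[bel b n h]_s (mdist (phi abs s) (E n h))%:E |
             h in [set: hist Y A n]].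

Definition ce_policy (pi : nat -> {mfun X >-> A}) : policy Y A :=
  fun n => (pi n \o E n : {mfun hist Y A n >-> A}).

Variables (FP Fc : nat -> R -> R).

Definition epsilon n : R := Fc n (fine (est_error n)).

Definition delta n : R :=
  (FP n (fine (est_error n)) + fine (est_error n.+1))%R.

(* Products use the convention 0 * +oo = 0. *)
Definition alpha n : \bar R :=
  (epsilon n)%:E +
  \sum_(n <= m < (horizon P).-1)
    ((delta m)%:E * Lip (mdp_value (abstract_mdp P abs) m.+1) +
     (epsilon m.+1)%:E).

End certainty_equivalence.

(* Main.v *)
Require Import Defs.
From HB Require Import structures.
From mathcomp Require Import all_boot all_order all_algebra.
From mathcomp Require Import all_classical all_reals all_analysis.
From mathcomp Require Import measurable_realfun ring lra.

(* The value V_n of the abstract MDP at the estimated state E_n(h) is compared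
   with the value at h of an arbitrary policy. One step of either recursion
   from the same action gives values that differ by at most
   epsilon_n + delta_n Lip(V_(n+1)): costs and next abstract states vary with
   the fiber according to Fc and FP, and Jensen's inequality turns the expected
   distance from phi(S_n) to E_n(h) into eta_n. Telescoping, every policy costs
   at least V_n(E_n(h)) - alpha_n, and the certainty equivalent one, which
   attains the minimum in the abstract recursion, at most
   V_n(E_n(h)) + alpha_n. When V_(n+1) is not Lipschitz the bound is only
   informative if delta_n = 0; then Wasserstein distance 0 forces the laws of
   the next abstract state to be equal. *)

Set Implicit Arguments.
Unset Strict Implicit.
Unset Printing Implicit Defensive.
Import Order.TTheory GRing.Theory Num.Theory.
Import numFieldNormedType.Exports.

Local Open Scope classical_set_scope.
Local Open Scope ring_scope.

(** * Integrals of bounded measurable functions *)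

Section bounded_measurable.
Context d (T : measurableType d) (R : realType).
Implicit Types (f g : T -> R) (m : {measure set T -> \bar R}).

(** Costs and value functions are bounded, so their integrals against probability measures are
    finite. This class is closed under all operations below, and the estimates can be made in [R]
    instead of [\bar R]. *)
Definition bmeas f :=
  measurable_fun [set: T] f /\ exists M : R, forall x, `|f x| <= M.

Lemma bmeas_cst (c : R) : bmeas (fun=> c).
Proof. by split; [exact: measurable_cst|exists `|c|]. Qed.

Lemma bmeasD f g : bmeas f -> bmeas g -> bmeas (fun x => f x + g x).
Proof.
move=> [mf [M fM]] [mg [N gN]]; split; first exact: measurable_funD.
by exists (M + N) => x; rewrite (le_trans (ler_normD _ _))// lerD.
Qed.

Lemma bmeasN f : bmeas f -> bmeas (fun x => - f x).
Proof.
move=> [mf [M fM]]; split; first exact: measurableT_comp.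
by exists M => x; rewrite normrN.
Qed.

Lemma bmeasB f g : bmeas f -> bmeas g -> bmeas (fun x => f x - g x).
Proof. by move=> bf bg; apply: bmeasD => //; exact: bmeasN. Qed.

Lemma bmeas_norm f : bmeas f -> bmeas (fun x => `|f x|).
Proof.
move=> [mf [M fM]]; split; first exact: measurableT_comp.
by exists M => x; rewrite normr_id.
Qed.

Lemma bmeas_max f g : bmeas f -> bmeas g ->
  bmeas (fun x => Num.max (f x) (g x)).
Proof.
move=> [mf [M fM]] [mg [N gN]]; split; first exact: measurable_maxr.
exists (Num.max M N) => x; rewrite le_max.
by have := fM x; have := gN x; case: (leP (f x) (g x)) => _ gxN fxM;
  rewrite ?gxN ?fxM ?orbT.
Qed.

Lemma bmeas_sum n (F : 'I_n -> T -> R) :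
  (forall i, bmeas (F i)) -> bmeas (fun x => \sum_(i < n) F i x).
Proof.
move=> bF; elim: n => [|n IHn] in F bF *.
  by under eq_fun do rewrite big_ord0; exact: bmeas_cst.
by under eq_fun do rewrite big_ord_recl; apply: bmeasD => //; exact: IHn.
Qed.

Section integral.
Variable m : {measure set T -> \bar R}.
Hypothesis m1 : m [set: T] = 1%E.

Lemma bmeas_integrable f : bmeas f -> m.-integrable [set: T] (EFin \o f).
Proof.
move=> [mf [M fM]].
apply: (@le_integrable _ _ _ _ _ measurableT _ (EFin \o cst M)).
- exact/measurable_EFinP.
- by move=> x _ /=; rewrite lee_fin (le_trans (fM x))// ler_norm.
- apply/integrableP; split; first exact/measurable_EFinP/measurable_cst.
  by rewrite /= integral_cst//= [m _]m1 mule1 ltry.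
Qed.

Lemma Rint_cst (c : R) : \int[m]_x c = c.
Proof. by rewrite Rintegral_cst//= m1 mulr1. Qed.

Lemma RintE f : bmeas f -> (\int[m]_x f x)%:E = (\int[m]_x (f x)%:E)%E.
Proof.
by move=> bf; rewrite fineK//; exact: integrable_fin_num (bmeas_integrable bf).
Qed.

Lemma RintD f g : bmeas f -> bmeas g ->
  \int[m]_x (f x + g x) = \int[m]_x f x + \int[m]_x g x.
Proof. by move=> bf bg; rewrite RintegralD//; exact: bmeas_integrable. Qed.

Lemma RintB f g : bmeas f -> bmeas g ->
  \int[m]_x (f x - g x) = \int[m]_x f x - \int[m]_x g x.
Proof. by move=> bf bg; rewrite RintegralB//; exact: bmeas_integrable. Qed.

Lemma le_Rint f g : bmeas f -> bmeas g -> (forall x, f x <= g x) ->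
  \int[m]_x f x <= \int[m]_x g x.
Proof.
by move=> bf bg fg; apply: le_Rintegral => //; exact: bmeas_integrable.
Qed.

Lemma normr_Rint f : bmeas f -> `|\int[m]_x f x| <= \int[m]_x `|f x|.
Proof.
by move=> bf; apply: le_normr_Rintegral => //; exact: bmeas_integrable.
Qed.

Lemma normr_Rint_le f (M : R) : bmeas f -> (forall x, `|f x| <= M) ->
  `|\int[m]_x f x| <= M.
Proof.
move=> bf fM; rewrite (le_trans (normr_Rint bf))//.
rewrite -[leRHS](Rint_cst M); apply: le_Rint => //; first exact: bmeas_norm.
exact: bmeas_cst.
Qed.

(* A bounded function is a nonnegative one minus a constant, so identities
   between integrals need only be checked on nonnegative functions. *)
Lemma Rint_shift f (M : R) : bmeas f ->
  \int[m]_x f x = \int[m]_x (f x + M) - M.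
Proof.
by move=> bf; rewrite RintD ?Rint_cst ?addrK//; exact: bmeas_cst.
Qed.

End integral.

Lemma eq_measure_Rint (m m' : {measure set T -> \bar R}) f :
  (forall U, measurable U -> m U = m' U) -> \int[m]_x f x = \int[m']_x f x.
Proof. by move=> mm'; congr fine; apply: eq_measure_integral => U /mm'. Qed.

End bounded_measurable.

Lemma bmeas_comp d d' (T : measurableType d) (T' : measurableType d')
    (R : realType) (h : T' -> T) (f : T -> R) :
  bmeas f -> measurable_fun [set: T'] h -> bmeas (f \o h).
Proof.
move=> [mf [M fM]] mh; split; first exact: measurableT_comp.
by exists M => x; exact: fM.
Qed.

(** * Integrals against composed, pushed-forward and averaged kernels *)

Section kernel_integrals.
Context d1 d2 d3 (X : measurableType d1) (Y : measurableType d2)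
  (Z : measurableType d3) (R : realType).

Lemma prob_kernelT (k : R.-pker X ~> Y) x : k x [set: Y] = 1%E.
Proof. exact: prob_kernel. Qed.

Lemma bmeas_Rint (k : R.-pker X ~> Y) (f : X * Y -> R) : bmeas f ->
  bmeas (fun x => \int[k x]_y f (x, y)).
Proof.
move=> bf; have [mf [M fM]] := bf.
have bfx x : bmeas (fun y => f (x, y)).
  by apply: (bmeas_comp bf); exact: pair1_measurable.
split; last by exists M => x; apply: normr_Rint_le => //; exact: prob_kernel.
under eq_fun do rewrite (Rint_shift (prob_kernelT k _) M (bfx _)).
apply: measurable_funB => //; apply: (measurableT_comp (f := fine)) => //.
apply: (measurable_fun_integral_finite_kernel (fun z => (f z + M)%:E) k).
  by move=> z; rewrite lee_fin -lerBlDr sub0r; case/ler_normlP: (fM z); lra.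
by apply/measurable_EFinP; exact: measurable_funD.
Qed.

Lemma bmeas_Rint_kernel (k : R.-pker X ~> Y) (f : Y -> R) : bmeas f ->
  bmeas (fun x => \int[k x]_y f y).
Proof.
move=> bf; apply: (@bmeas_Rint k (f \o snd)).
exact: (bmeas_comp bf).
Qed.

End kernel_integrals.

Section kernel_operations.
Context d1 d2 d3 (X : measurableType d1) (Y : measurableType d2)
  (Z : measurableType d3) (R : realType).

Lemma Rint_kbind (l : R.-pker X ~> Y) (k : R.-pker (X * Y) ~> Z) x
    (f : Z -> R) : bmeas f ->
  \int[kbind l k x]_z f z = \int[l x]_y \int[k (x, y)]_z f z.
Proof.
move=> bf; have [mf [M fM]] := bf.
have bfM : bmeas (fun z => f z + M) by apply: bmeasD => //; exact: bmeas_cst.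
have f0 z : 0 <= f z + M by case/ler_normlP: (fM z); lra.
have bk g : bmeas g -> bmeas (fun y => \int[k (x, y)]_z g z).
  move=> bg; apply: (bmeas_comp (bmeas_Rint_kernel k bg)).
  exact: pair1_measurable.
rewrite (Rint_shift (prob_kernelT (kbind l k) x) M bf).
rewrite (Rint_shift (prob_kernelT l x) M (bk _ bf)).
congr (_ - _); apply: EFin_inj.
rewrite (RintE (prob_kernelT (kbind l k) x) bfM) RintE//; last 2 first.
- exact: prob_kernel.
- by apply: bmeasD; [exact: bk|exact: bmeas_cst].
rewrite (@integral_kcomp _ _ _ _ _ _ _ l k x (fun z => (f z + M)%:E))//.
  apply: eq_integral => y _; rewrite -(RintE (prob_kernelT k _))//.
  congr EFin; rewrite RintD ?Rint_cst//; try exact: prob_kernelT.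
  exact: bmeas_cst.
by apply/measurable_EFinP; case: bfM.
Qed.

Lemma Rint_kdirac (f : X -> Y) (mf : measurable_fun [set: X] f) x (g : Y -> R) :
  measurable_fun [set: Y] g -> \int[kdirac mf x]_y g y = g (f x).
Proof.
move=> mg; rewrite /Rintegral /kdirac/= integral_dirac//; last first.
  exact/measurable_EFinP.
by rewrite diracT mul1e.
Qed.

Lemma Rint_mkpush (k : R.-pker X ~> Y) (f : Y -> Z)
    (mf : measurable_fun [set: Y] f) x (g : Z -> R) : bmeas g ->
  \int[mkpush k mf x]_z g z = \int[k x]_y g (f y).
Proof.
move=> bg; have [mg _] := bg.
rewrite /Rintegral /mkpush /kpush integral_pushforward//.
- exact/measurable_EFinP.
- by apply: (bmeas_integrable (prob_kernelT k x)); exact: (bmeas_comp bg).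
Qed.

End kernel_operations.

Lemma Rint_mkfiber d1 d2 d3 d4 (X : measurableType d1) (S : measurableType d2)
    (A : measurableType d3) (Z : measurableType d4) (R : realType)
    (lam : R.-pker X ~> S) (phi : S -> X)
    (mphi : forall x, measurable (phi @^-1` [set x]))
    (lam1 : forall x, lam x (phi @^-1` [set x]) = 1%E)
    (k : R.-pker (S * A) ~> Z) x a (f : Z -> R) : bmeas f ->
  \int[mkfiber mphi k lam1 (x, a)]_z f z =
  \int[lam x]_s \int[k (s, a)]_z f z.
Proof.
move=> bf; have mswap : measurable_fun [set: (X * A) * S]
    (fun z => (z.2, z.1.2) : S * A).
  by apply: measurable_fun_pair => //; exact: measurableT_comp.
rewrite (@eq_measure_Rint _ _ _ _
  (kbind (kpre lam measurable_fst) (kpre k mswap) (x, a))) ?Rint_kbind//.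
move=> U mU; rewrite [LHS](fiber_integralE mphi lam1 x)//.
apply: (measurableT_comp (f := k ^~ U)); first exact: measurable_kernel.
exact: pair2_measurable.
Qed.

(** * Jensen's inequality *)

Ltac clear_ereal_lra :=
  repeat match goal with H : context [extended _] |- _ => clear H end; lra.

Section concave.
Context (R : realType) (F : R -> R).
Hypothesis cF : concave_nondecreasing F.

(** Slopes of chords of a concave function decrease; the inequality is cross-multiplied to avoid
    quotients. *)
Let chord x e y : 0 <= x -> x < e -> e < y ->
  (F y - F e) * (e - x) <= (F e - F x) * (y - e).
Proof.
move=> x0 xe ey; have [_ _ cv] := cF.
have yx : 0 < y - x by lra.
(* The weight that makes [e] the convex combination [t * x + (1 - t) * y]. *)
pose t := (y - e) / (y - x).
have tE : t * (y - x) = y - e by rewrite /t divfK// gt_eqF.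
have t0 : 0 <= t by apply: divr_ge0; lra.
have t1 : t <= 1 by rewrite ler_pdivrMr//; lra.
have := cv x y t x0 ltac:(lra) t0 t1.
have -> : t * x + (1 - t) * y = e.
  by rewrite (_ : _ + _ = y - t * (y - x)); [rewrite tE; ring|ring].
move=> H; have := ler_wpM2r (ltW yx) H.
have -> : (t * F x + (1 - t) * F y) * (y - x) =
  (t * (y - x)) * F x + ((y - x) - t * (y - x)) * F y by ring.
rewrite tE; lra.
Qed.

(** A supporting line from above at an interior point. Its slope is the supremum of the chord slopes
    to the right of [e], that is, the right derivative. The chord from 0 to [e] bounds them, which
    is where [0 < e] enters, and monotonicity of [F] makes them nonnegative. *)
Lemma concave_support e : 0 < e -> exists2 k, 0 <= k &
  forall x, 0 <= x -> F x <= F e + k * (x - e).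
Proof.
move=> e0; have [F0 Fnd _] := cF.
pose s := [set (F y - F e) / (y - e) | y in [set y | e < y]].
have slope_le x z : 0 <= x -> x < e -> s z -> z <= (F e - F x) / (e - x).
  move=> x0 xe [y /= ey <-].
  rewrite ler_pdivrMr ?subr_gt0// mulrAC ler_pdivlMr ?subr_gt0//.
  exact: chord.
have hs : has_sup s.
  split; first by exists ((F (e + 1) - F e) / (e + 1 - e)), (e + 1) => //=; lra.
  by exists ((F e - F 0) / (e - 0)) => z; exact: slope_le.
exists (sup s) => [|x x0].
  apply: le_trans (ub_le_sup hs.2 _).
    2: by exists (e + 1) => //=; lra.
  by apply: divr_ge0; [rewrite subr_ge0; apply: Fnd; lra|lra].
have [xe|ex|->] := ltgtP x e; last by rewrite subrr mulr0 addr0.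
- have : sup s <= (F e - F x) / (e - x).
    by apply: ge_sup; [exact: hs.1|move=> z; exact: slope_le].
  by rewrite ler_pdivlMr ?subr_gt0//; lra.
- have : (F x - F e) / (x - e) <= sup s.
    by apply: ub_le_sup; [exact: hs.2|exists x].
  by rewrite ler_pdivrMr ?subr_gt0//; lra.
Qed.

End concave.

Lemma concave_nondecreasing_id (R : realType) :
  concave_nondecreasing (fun x : R => x).
Proof. by split. Qed.

(* Products use the convention 0 * +oo = 0; L may be the Lipschitz constant of
   a function that is not Lipschitz. *)
Lemma concave_Jensen d (T : measurableType d) (R : realType)
    (m : {measure set T -> \bar R}) (F : R -> R) (L : \bar R) (D g : T -> R)
    (e : R) :
  m [set: T] = 1%E -> concave_nondecreasing F -> (0 <= L)%E ->
  measurable_fun [set: T] D -> (forall x, 0 <= D x) ->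
  (\int[m]_x (D x)%:E <= e%:E)%E ->
  bmeas g -> (forall x, ((g x)%:E <= L * (F (D x))%:E)%E) ->
  ((\int[m]_x g x)%R%:E <= L * (F e)%:E)%E.
Proof.
move=> m1 cF L0 mD D0 De bg gD; have [F0 Fnd _] := cF.
have mED : measurable_fun [set: T] (EFin \o D) by exact/measurable_EFinP.
have Dge0 : (0 <= \int[m]_x (D x)%:E)%E.
  by apply: integral_ge0 => x _; rewrite lee_fin.
have iD : m.-integrable [set: T] (EFin \o D).
  apply/integrableP; split => //; apply: le_lt_trans (ltry e).
  by under eq_integral do rewrite /= ger0_norm//.
have e0 : 0 <= e by rewrite -lee_fin; exact: le_trans Dge0 De.
(* At [e = 0] there may be no supporting line, since [F] can jump or have infinite slope there. But
   then [D] vanishes almost everywhere, and [g] is almost everywhere at most [L * F 0]. *)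
move: e0; rewrite le_eqVlt => /predU1P[e0|e0].
  have /ae_eq_integral_abs : (\int[m]_x `|(EFin \o D) x| = 0)%E.
    under eq_integral do rewrite /= ger0_norm//.
    by apply/eqP; rewrite eq_le Dge0 andbT (le_trans De)// -e0.
  move=> /(_ measurableT mED) D_ae0.
  have : (0 <= L * (F e)%:E)%E by rewrite mule_ge0// lee_fin F0// -e0.
  case LF : (L * (F e)%:E)%E => [r| |]; [|by move=> _; exact: leey|by []].
  (* The excess of [g] over the bound [r]: it is zero almost everywhere, and [g <= h + r] holds
     everywhere. *)
  move=> _; pose h x := Num.max (g x - r) 0.
  have bh : bmeas h.
    by apply: bmeas_max; [apply: bmeasB => //|]; exact: bmeas_cst.
  have h0 : \int[m]_x h x = 0.
    apply: EFin_inj; rewrite (RintE m1 bh).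
    transitivity (\int[m]_(x in [set: T]) cst 0 x)%E; last by rewrite integral0.
    apply: ge0_ae_eq_integral => //.
    - by apply/measurable_EFinP; case: bh.
    - by move=> x _; rewrite lee_fin /h le_max lexx orbT.
    - move: D_ae0; apply: filterS => x /(_ I) /= [Dx0] _.
      congr EFin; rewrite /h; apply/max_idPr; rewrite subr_le0 -lee_fin -LF.
      by rewrite -e0 -Dx0; exact: gD.
  rewrite lee_fin (le_trans (le_Rint m1 bg (bmeasD bh (bmeas_cst _ r)) _))//.
    by move=> x; rewrite /h -lerBlDr le_max lexx.
  by rewrite RintD// ?h0 ?add0r ?Rint_cst//; exact: bmeas_cst.
have [k k0 Fk] := concave_support cF e0.
case: L L0 gD => [r L0 gD|_ gD|]//.
  have r0 : 0 <= r by rewrite -lee_fin.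
  have iaD : m.-integrable [set: T] (EFin \o (fun x => r * k * D x)).
    by apply: (integrableZl measurableT (r * k) iD).
  have bc := bmeas_integrable m1 (bmeas_cst T (r * (F e - k * e))).
  rewrite -EFinM lee_fin.
  (* Integrate the supporting line at [e]. As [k] is nonnegative, an upper bound on the mean of [D]
     is enough. *)
  apply: (@le_trans _ _ (\int[m]_x (r * (F e - k * e) + r * k * D x))).
    apply: le_Rintegral => //; first exact: bmeas_integrable.
      by apply: (integrableD measurableT bc iaD).
    move=> x _; apply: (@le_trans _ _ (r * F (D x))).
      by rewrite -lee_fin EFinM.
    by have := ler_wpM2l r0 (Fk _ (D0 x)); clear_ereal_lra.
  rewrite RintegralD// (Rint_cst m1) RintegralZl//.
  have : \int[m]_x D x <= e.
    by rewrite -lee_fin fineK//; exact: integrable_fin_num.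
  by move=> /(ler_wpM2l (mulr_ge0 r0 k0)); clear_ereal_lra.
(* Here [L] is infinite. Only [F e = 0] is informative: the supporting line at 0 then forces
   [k = 0], so [F] vanishes on the nonnegative reals and [g <= 0] pointwise. *)
have := F0 _ (ltW e0); rewrite le_eqVlt => /predU1P[Fe0|Fe0]; last first.
  by rewrite gt0_mulye ?lte_fin// leey.
rewrite -Fe0 mule0 lee_fin.
have FD0 x : F (D x) = 0.
  have : 0 <= - (k * e) by have := Fk 0 (lexx _); have := F0 0 (lexx _);
    clear_ereal_lra.
  rewrite oppr_ge0 (pmulr_lle0 _ e0) => k_le0.
  have k_0 : k = 0 by clear_ereal_lra.
  by have := Fk _ (D0 x); have := F0 _ (D0 x); rewrite k_0; clear_ereal_lra.
have := le_Rint m1 bg (bmeas_cst T 0); rewrite Rint_cst//; apply => x.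
by have := gD x; rewrite FD0 mule0 lee_fin.
Qed.

(** * Lipschitz functions on metric Borel spaces *)

Section lipschitz.
Context (R : realType) dX (X : borelSpaceType R dX).
Implicit Type f : X -> R.

Lemma Lip_ge0 f : (0 <= Lip f)%E.
Proof. by apply: le_ereal_inf_tmp => _ [L [L0 _] <-]; rewrite lee_fin. Qed.

Variant Lip_spec f : \bar R -> Prop :=
| LipFin (L : R) of 0 <= L & (forall x y, `|f x - f y| <= L * mdist x y) :
    Lip_spec f L%:E
| LipInf : Lip_spec f +oo%E.

(** A finite infimum of Lipschitz constants is itself one: for fixed distinct points, every
    admissible constant dominates the difference quotient, hence so does the infimum. *)
Lemma LipP f : Lip_spec f (Lip f).
Proof.
have := Lip_ge0 f; case LE : (Lip f) => [l| |] // l0; last exact: LipInf.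
apply: LipFin; first by rewrite -lee_fin.
move=> x y; have [<-|xy] := eqVneq x y.
  by rewrite subrr normr0 mdistxx mulr0.
have dxy : 0 < mdist x y by rewrite mdist_gt0.
rewrite -ler_pdivrMr// -lee_fin -LE.
apply: le_ereal_inf_tmp => _ [L [L0 fL] <-].
by rewrite lee_fin ler_pdivrMr.
Qed.

Lemma le_Lip f x y : (`|f x - f y|%:E <= Lip f * (mdist x y)%:E)%E.
Proof.
case: LipP => [L L0 fL|]; first by rewrite -EFinM lee_fin.
have [<-|xy] := eqVneq x y; first by rewrite subrr normr0 mdistxx mule0.
by rewrite gt0_mulye ?leey// lte_fin mdist_gt0.
Qed.

Lemma lipschitz_measurable f (L : R) :
  (forall x y, `|f x - f y| <= L * mdist x y) -> measurable_fun [set: X] f.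
Proof.
move=> fL; have cf : continuous f.
  move=> x; apply/cvgrPdist_le => /= e e0; apply/nbhs_ballP.
  have L1 : 0 < `|L| + 1 by rewrite ltr_wpDl.
  (* [L] may be zero or negative, so the modulus of continuity uses a positive constant above it. *)
  exists (e / (`|L| + 1)); first by rewrite /= divr_gt0.
  move=> y; rewrite ballEmdist/= ltr_pdivlMr// => xy.
  rewrite (le_trans (fL x y))// (le_trans _ (ltW xy))// mulrC.
  rewrite ler_wpM2l ?mdist_ge0//.
  by rewrite (le_trans (ler_norm L))// lerDl.
apply: (measurability _ (RGenOpens.measurableE R)) => _ /= [_ [a [b ->]] <-].
rewrite setTI borel_measurableE; apply: sub_sigma_algebra => /=.
by move/continuousP : cf; apply; exact: interval_open.
Qed.

Lemma mdist_lipschitz (a x y : X) : `|mdist a x - mdist a y| <= mdist x y.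
Proof.
have := metric_triangle a x y; have := metric_triangle a y x.
by rewrite (metric_sym y x) ler_norml => ? ?; lra.
Qed.

Lemma measurable_mdist (a : X) : measurable_fun [set: X] (mdist a).
Proof.
by apply: (@lipschitz_measurable _ 1) => x y; rewrite mul1r mdist_lipschitz.
Qed.

(** Take the distance to the complement of [U], or the constant 1 when the complement is empty. *)
Lemma open_lipschitz_gt0 (U : set X) : open U -> exists f : X -> R,
  [/\ forall x, 0 <= f x, forall x y, `|f x - f y| <= mdist x y,
      forall x, U x -> 0 < f x & forall x, ~ U x -> f x = 0].
Proof.
move=> oU; have [->|UT] := eqVneq U setT.
  exists (fun=> 1); split => [x|x y|x _|x /(_ I)//].
  - exact: ler01.
  - by rewrite subrr normr0 mdist_ge0.
  - exact: ltr01.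
pose D x := [set mdist x a | a in ~` U]; pose f x := inf (D x).
have D0 x : lbound (D x) 0 by move=> _ [a _ <-]; exact: mdist_ge0.
have lbD x : has_lbound (D x) by exists 0.
have neD x : D x !=set0.
  apply: image_nonempty; apply/set0P; apply: contra UT => /eqP U0.
  by rewrite -[U]setCK U0 setC0.
have fD x y : f x <= mdist x y + f y.
  rewrite -lerBlDl; apply: lb_le_inf => // _ [a Ua <-]; rewrite lerBlDl.
  apply: le_trans (metric_triangle x y a).
  by apply: ge_inf => //; exists a.
exists f; split.
- by move=> x; exact: lb_le_inf.
- move=> x y; have := fD x y; have := fD y x.
  by rewrite (metric_sym y x) ler_norml => ? ?; lra.
- move=> x Ux; have /nbhs_ballP[e /= e0 xeU] : nbhs x U by exact: open_nbhs_nbhs.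
  apply: (lt_le_trans e0); apply: lb_le_inf => // _ [a Ua <-].
  by rewrite leNgt; apply/negP => xa; apply/Ua/xeU; rewrite ballEmdist.
- move=> x Ux; apply/le_anti; rewrite [0 <= _]lb_le_inf// andbT -(mdistxx x).
  by apply: ge_inf => //; exists x.
Qed.

(** As [n] grows, these truncations increase to the indicator of the set where [f] is positive. *)
Lemma bmeas_trunc_lipschitz f n : (forall x, 0 <= f x) ->
  (forall x y, `|f x - f y| <= mdist x y) ->
  bmeas (fun x => Num.min 1 (n%:R * f x)).
Proof.
move=> f0 fL; split.
  apply: measurable_minr; first exact: measurable_cst.
  apply: measurable_funM; first exact: measurable_cst.
  by apply: (@lipschitz_measurable _ 1) => x y; rewrite mul1r.
exists 1 => x; rewrite ger0_norm ?ge_min ?lexx//.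
by rewrite le_min ler01 mulr_ge0.
Qed.

Section equal_on_lipschitz.
Variables m m' : {measure set X -> \bar R}.
Hypotheses (m1 : m [set: X] = 1%E) (m'1 : m' [set: X] = 1%E).

Let cvg_trunc (mu : {measure set X -> \bar R}) f (U : set X) :
    (forall x, 0 <= f x) -> (forall x y, `|f x - f y| <= mdist x y) ->
    (forall x, U x -> 0 < f x) -> (forall x, ~ U x -> f x = 0) ->
    open U ->
  (\int[mu]_x (Num.min 1 (n%:R * f x))%:E @[n --> \oo] --> mu U)%E.
Proof.
move=> f0 fL fU fU0 oU.
have mU : measurable U.
  by rewrite borel_measurableE; exact: sub_sigma_algebra.
pose g n x : \bar R := (Num.min 1 (n%:R * f x))%:E.
have -> : mu U = (\int[mu]_x limn (g ^~ x))%E.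
  rewrite -[U in LHS]setIT -integral_indic//; apply: eq_integral => x _.
  apply/esym/cvg_lim => //; rewrite indicE; have [xU|xU] := boolP (x \in U).
    apply: cvg_near_cst; exists (Num.truncn (f x)^-1).+1 => // n /= nx.
    rewrite /g; congr EFin; apply/min_idPl.
    have fx0 : 0 < f x by apply: fU; rewrite inE in xU.
    rewrite -ler_pdivrMr// mul1r (le_trans (ltW (truncnS_gt _)))//.
    by rewrite ler_nat.
  rewrite (_ : g ^~ x = cst 0%E); first exact: cvg_cst.
  apply/funext => n; rewrite /g fU0 ?mulr0; last by rewrite notin_setE in xU.
  by rewrite (min_idPr _).
apply: cvg_monotone_convergence => //.
- move=> n; apply/measurable_EFinP.
  by have [] := bmeas_trunc_lipschitz n f0 fL.
- by move=> n x _; rewrite lee_fin le_min ler01 mulr_ge0.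
- move=> x _ a b ab; rewrite lee_fin le_min ge_min lexx/=.
  by rewrite ge_min ler_wpM2r ?orbT// ler_nat.
Qed.

(** Indicators of open sets are increasing limits of bounded Lipschitz functions, so by monotone
    convergence the measures agree on open sets. These are stable under intersection and generate
    the Borel sets. *)
Lemma eq_measure_lipschitz :
  (forall f, bmeas f -> (exists L : R, 0 <= L /\
      forall x y, `|f x - f y| <= L * mdist x y) ->
    \int[m]_x f x = \int[m']_x f x) ->
  forall U, measurable U -> m U = m' U.
Proof.
move=> mm'; apply: (measure_unique open (fun=> setT)) => //.
- exact: borel_measurableE.
- by move=> U V oU oV; exact: openI.
- by move=> _; exact: openT.
- by rewrite bigcup_const.
- move=> U oU; have [f [f0 fL fU fU0]] := open_lipschitz_gt0 oU.
  have := @cvg_trunc m _ _ f0 fL fU fU0 oU.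
  have := @cvg_trunc m' _ _ f0 fL fU fU0 oU.
  rewrite (_ : (fun n => _) = (fun n =>
      \int[m]_x (Num.min 1 (n%:R * f x))%:E))%E; last first.
    apply/funext => n; have bf := bmeas_trunc_lipschitz n f0 fL.
    rewrite -(RintE m1 bf) -(RintE m'1 bf) mm'//.
    (* [n%:R * f] has Lipschitz constant [n], and truncation at 1 does not increase differences. *)
    exists n%:R; split => // x y.
    apply: (@le_trans _ _ (n%:R * `|f x - f y|)); last exact: ler_wpM2l.
    rewrite -[n%:R in leRHS]normr_nat -normrM mulrBr.
    set u := n%:R * f x; set v := n%:R * f y.
    have uv := ler_norm (u - v); have vu := ler_norm (v - u).
    rewrite distrC in vu; have n0 := normr_ge0 (u - v).
    rewrite ler_norml; apply/andP; split.
      by case: (leP 1 u) => ?; case: (leP 1 v) => ?; lra.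
    by case: (leP 1 u) => ?; case: (leP 1 v) => ?; lra.
  by move=> /cvg_lim <-// /cvg_lim <-.
- by move=> _; rewrite m1 ltry.
Qed.

End equal_on_lipschitz.

End lipschitz.

(** * Wasserstein distance *)

(* Neither function is required to be measurable: the integral of a nonnegative
   function is a supremum over the simple functions below it. The distance on
   X * X need not be known to be measurable. *)
Lemma le_integralT_nonneg d (T : measurableType d) (R : realType)
    (m : {measure set T -> \bar R}) (f g : T -> \bar R) :
  (forall x, 0 <= f x)%E -> (forall x, f x <= g x)%E ->
  (\int[m]_x f x <= \int[m]_x g x)%E.
Proof.
move=> f0 fg; rewrite !ge0_integralTE//; last by move=> x; exact: le_trans (fg x).
by apply: le_ereal_sup => _ [h hf <-]; exists h => // x; exact: le_trans (fg x).
Qed.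

Section wasserstein.
Context (R : realType) dX (X : borelSpaceType R dX).
Variables m m' : {measure set X -> \bar R}.
Hypotheses (m1 : m [set: X] = 1%E) (m'1 : m' [set: X] = 1%E).

Let Rint_marginal d (T : measurableType d) (g : probability T R) (p : T -> X)
    (mu : {measure set X -> \bar R}) (V : X -> R) :
  measurable_fun [set: T] p -> (forall U, measurable U -> g (p @^-1` U) = mu U) ->
  bmeas V -> \int[mu]_x V x = \int[g]_z V (p z).
Proof.
move=> mp gmu bV; have g1 : g [set: T] = 1%E by exact: probability_setT.
transitivity (fine (\int[g]_(x in p @^-1` setT) ((EFin \o V) \o p) x)%E).
  rewrite -(integral_pushforward mp (f := EFin \o V))//.
  - by congr fine; apply: eq_measure_integral => U mU _; rewrite -gmu.
  - by apply/measurable_EFinP; case: bV.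
  - by apply: (bmeas_integrable g1); exact: (bmeas_comp bV).
by rewrite preimage_setT.
Qed.

(** The easy half of Kantorovich-Rubinstein duality: under any coupling, the difference of the two
    integrals is at most the mean of [|V z.1 - V z.2|], hence at most [L] times the mean distance.
    Dividing by [L] gives a lower bound for the infimum over couplings. *)
Lemma le_wasserstein (V : X -> R) (L : R) : bmeas V -> 0 < L ->
  (forall x y, `|V x - V y| <= L * mdist x y) ->
  ((`|\int[m]_x V x - \int[m']_x V x| / L)%:E <= wasserstein m m')%E.
Proof.
move=> bV L0 VL; apply: le_ereal_inf_tmp => _ [g gm <-].
have g1 : g [set: X * X] = 1%E by exact: probability_setT.
rewrite (@Rint_marginal _ _ g fst m)//; last first.
  move=> U /gm[+ _]; rewrite (_ : _ @^-1` _ = U `*` setT)//.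
  by apply/seteqP; split => z //= [].
rewrite (@Rint_marginal _ _ g snd m')//; last first.
  move=> U /gm[_ +]; rewrite (_ : _ @^-1` _ = setT `*` U)//.
  by apply/seteqP; split => z //= [].
have bV1 : bmeas (fun z : X * X => V z.1).
  by apply: (bmeas_comp bV); exact: measurable_fst.
have bV2 : bmeas (fun z : X * X => V z.2).
  by apply: (bmeas_comp bV); exact: measurable_snd.
have bVV := bmeas_norm (bmeasB bV1 bV2).
rewrite -(RintB g1 bV1 bV2); apply: (@le_trans _ _
    ((\int[g]_z (`|V z.1 - V z.2| / L))%R%:E)).
  rewrite lee_fin RintegralZr//; last exact: bmeas_integrable.
  rewrite ler_wpM2r ?invr_ge0 ?(ltW L0)//.
  by apply: normr_Rint => //; exact: bmeasB.
rewrite RintE//.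
  apply: le_integralT_nonneg => z; rewrite lee_fin ?divr_ge0 ?(ltW L0)//.
  by rewrite ler_pdivrMr// mulrC.
have [mV [M VM]] := bVV; split; first exact: measurable_funM.
exists (M / L) => z; rewrite normrM (gtr0_norm (_ : 0 < L^-1)) ?invr_gt0//.
by rewrite ler_wpM2r ?VM// invr_ge0 ltW.
Qed.

Lemma wasserstein_ge0 : (0 <= wasserstein m m')%E.
Proof.
apply: le_ereal_inf_tmp => _ [g _ <-]; apply: integral_ge0 => z _.
by rewrite lee_fin mdist_ge0.
Qed.

Lemma Rint_wasserstein (V : X -> R) (w : R) : bmeas V ->
  (wasserstein m m' <= w%:E)%E ->
  (`|\int[m]_x V x - \int[m']_x V x|%:E <= Lip V * w%:E)%E.
Proof.
move=> bV mw.
have lipW f L : bmeas f -> 0 < L -> (forall x y, `|f x - f y| <= L * mdist x y) ->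
    `|\int[m]_x f x - \int[m']_x f x| <= L * w.
  move=> bf L0 fL; rewrite mulrC -ler_pdivrMr// -lee_fin.
  exact: le_trans (le_wasserstein bf L0 fL) mw.
have w0 : 0 <= w by rewrite -lee_fin; exact: le_trans wasserstein_ge0 mw.
have lip0 f (L : R) : bmeas f -> 0 <= L ->
    (forall x y, `|f x - f y| <= L * mdist x y) ->
    `|\int[m]_x f x - \int[m']_x f x| <= L * w.
  move=> bf L0 fL; apply/ler_addgt0Pr => e e0.
  have w1 : 0 < w + 1 by rewrite ltr_wpDl.
  (* [lipW] needs a positive constant, while [L] may be 0. The increment contributes
     [e * w / (w + 1)], at most [e] even when [w = 0]. *)
  apply: (@le_trans _ _ ((L + e / (w + 1)) * w)).
    apply: lipW => // [|x y]; first by rewrite ltr_wpDl// divr_gt0.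
    by rewrite (le_trans (fL x y))// ler_wpM2r ?mdist_ge0// lerDl divr_ge0// ltW.
  rewrite mulrDl lerD2l mulrAC ler_pdivrMr// ler_pM2l//.
  by rewrite lerDl.
case: LipP => [L L0 VL|]; first by rewrite -EFinM lee_fin lip0.
move: w0; rewrite le_eqVlt => /predU1P[w0|w0]; last first.
  by rewrite gt0_mulye ?lte_fin// leey.
rewrite -w0 mule0 lee_fin (@eq_measure_Rint _ _ _ m m') ?subrr ?normr0//.
(* [V] is not Lipschitz here, but with [w = 0] the estimate [lip0] shows that the measures agree on
   all bounded Lipschitz functions, hence are equal. *)
apply: eq_measure_lipschitz => // f bf [L [L0 fL]]; apply/eqP.
rewrite -subr_eq0 -normr_le0; have := lip0 _ _ bf L0 fL.
by rewrite -w0 mulr0.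
Qed.

End wasserstein.

(** * Recursions for the value of a policy *)

Lemma measure_unique_rectangles d1 d2 (S : measurableType d1)
    (Y : measurableType d2) (R : realType)
    (m m' : {measure set (S * Y) -> \bar R}) : (m [set: S * Y] < +oo)%E ->
  (forall MS MY, measurable MS -> measurable MY ->
    m (MS `*` MY) = m' (MS `*` MY)) ->
  forall U, measurable U -> m U = m' U.
Proof.
move=> moo mm'.
apply: (measure_unique [set MS `*` MY | MS in measurable & MY in measurable]
  (fun=> setT)) => //.
- exact: measurable_prod_measurableType.
- move=> _ _ [A mA [B mB <-]] [C mC [D mD <-]]; rewrite -setXI.
  exists (A `&` C); first exact: measurableI.
  by exists (B `&` D) => //; exact: measurableI.
- by move=> _; exists setT => //; exists setT => //; rewrite setXTT.
- by rewrite bigcup_const.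
- by move=> _ [A mA [B mB <-]]; exact: mm'.
Qed.

Section policy_recursion.
Context (R : realType) dS dY dA (S : borelSpaceType R dS)
  (Y : borelSpaceType R dY) (A : borelSpaceType R dA) (P : pomdp S Y A)
  (b : belief P).

Lemma bmeas_cost n : (n < horizon P)%N -> bmeas (cost P n).
Proof.
move=> nT; split; first exact: measurable_funPT.
by have [c cP] := cost_bounded P; exists c => -[s a]; exact: cP.
Qed.

Lemma bmeas_cost_act n a : (n < horizon P)%N -> bmeas (fun s => cost P n (s, a)).
Proof.
by move=> nT; apply: (bmeas_comp (bmeas_cost nT)); exact: pair2_measurable.
Qed.

Lemma Rint_predict n (h : hist Y A n) a (f : S * Y -> R) : bmeas f ->
  \int[predict P (bel b n) (h, a)]_z f z =
  \int[bel b n h]_s \int[trans P n (s, a)]_z f z.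
Proof. by move=> bf; rewrite /predict Rint_kbind. Qed.

(** The tower property: conditioning on the next observation replaces the next state by its
    posterior. The disintegration equation is given on rectangles only; it extends to functions
    because rectangles determine the joint law. *)
Lemma Rint_predict_bel n (h : hist Y A n) a (f : S * Y -> R) :
    (n.+1 < horizon P)%N -> bmeas f ->
  \int[predict P (bel b n) (h, a)]_z f z =
  \int[predict P (bel b n) (h, a)]_z
    \int[bel b n.+1 (hnext h a z.2)]_s f (s, z.2).
Proof.
move=> nT bf.
have mh : measurable_fun [set: (hist Y A n * A) * Y]
    (fun z => hnext z.1.1 z.1.2 z.2).
  by apply: measurable_hnext => //; exact: measurableT_comp.
have ms : measurable_fun [set: ((hist Y A n * A) * Y) * S]
    (fun z => (z.2, z.1.2) : S * Y).
  by apply: measurable_fun_pair => //; exact: measurableT_comp.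
pose l := mkpush (predict P (bel b n)) measurable_snd.
(* [joint] draws [y] from the predicted observation law, then the state from the belief at the
   extended history. *)
pose joint := kbind l (kbind (kpre (bel b n.+1) mh) (kdirac ms)).
rewrite (@eq_measure_Rint _ _ _ _ (joint (h, a))).
  have [mf _] := bf.
  rewrite Rint_kbind//.
  have bg : bmeas (fun y => \int[bel b n.+1 (hnext h a y)]_s f (s, y)).
    have bfs : bmeas (fun z : Y * S => f (z.2, z.1)).
      by apply: (bmeas_comp bf); exact: measurable_fun_pair.
    have mhy : measurable_fun [set: Y] (fun y => hnext h a y).
      exact: measurable_hnext.
    exact: (bmeas_Rint (kpre (bel b n.+1) mhy) bfs).
  rewrite -[RHS](Rint_mkpush (predict P (bel b n)) measurable_snd (h, a) bg).
  apply: eq_Rintegral => y _; rewrite Rint_kbind//.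
  by apply: eq_Rintegral => s _; rewrite Rint_kdirac.
apply: measure_unique_rectangles => [|MS MY mMS mMY].
  by rewrite [X in (X < _)%E](prob_kernelT (predict P (bel b n))) ltry.
rewrite (bel_next b nT)// integral_mkcond; apply: eq_integral => y _.
have kdE s : kdirac ms ((h, a), y, s) (MS `*` MY) =
    ((s \in MS) && (y \in MY))%:R%:E :> \bar R.
  by rewrite [LHS]diracE in_setX.
rewrite patchE /kbind /mkcomp /kcomp /=; case: ifPn => yMY.
  rewrite -[MS in LHS]setIT -integral_indic//.
  by apply: eq_integral => s _; rewrite [RHS]kdE indicE yMY andbT.
by apply/esym/integral0_eq => s _; rewrite [LHS]kdE (negbTE yMY) andbF.
Qed.

Variable mu : policy Y A.

Definition reward k n (w : k.+1.-tuple (S * A)) : R :=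
  \sum_(j < k.+1) cost P (n + j) (tnth w j).

Lemma bmeas_reward k n : (n + k < horizon P)%N -> bmeas (@reward k n).
Proof.
move=> nkT; apply: bmeas_sum => j; apply: (bmeas_comp (bmeas_cost _)).
  by apply: leq_ltn_trans nkT; rewrite leq_add2l -ltnS.
exact: measurable_tnth.
Qed.

(* There are k + 1 steps, at times n, ..., n + k. *)
Definition state_value k n (sh : S * hist Y A n) : R :=
  \int[traj P mu k n sh]_w reward n w.

Lemma bmeas_state_value k n : (n + k < horizon P)%N ->
  bmeas (@state_value k n).
Proof. by move=> nkT; apply: bmeas_Rint_kernel; exact: bmeas_reward. Qed.

Lemma state_value0 n sh : (n < horizon P)%N ->
  @state_value 0 n sh = cost P n (act mu sh).
Proof.
move=> nT; rewrite /state_value /= Rint_kdirac.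
  by rewrite /reward big_ord1 addn0.
by have [] := @bmeas_reward 0 n; rewrite ?addn0.
Qed.

Lemma state_valueS k n sh : (n + k.+1 < horizon P)%N ->
  @state_value k.+1 n sh = cost P n (act mu sh) +
    \int[trans P n (act mu sh)]_z state_value k (act_next mu (sh, z)).
Proof.
move=> nkT; have bR := bmeas_reward nkT; have [mR _] := bR.
have bR' : bmeas (@reward k n.+1) by apply: bmeas_reward; rewrite addSnnS.
rewrite /state_value /= Rint_kbind//.
(* A trajectory is the current state-action pair followed by a trajectory from time [n.+1], so the
   current cost splits off as a constant. *)
transitivity (\int[kbind (kpre (trans P n) (measurable_act mu (n := n)))
  (kpre (traj P mu k n.+1) (measurable_act_next mu (n := n))) sh]_w
  (cost P n (act mu sh) + reward n.+1 w)).
  apply: eq_Rintegral => w _; rewrite Rint_kdirac// /reward big_ord_recl addn0.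
  congr (_ + _); apply: eq_bigr => j _.
  by rewrite addSnnS /act_cons tnthS.
rewrite RintD ?Rint_cst; try exact: (prob_kernelT (kbind _ _)); last 2 first.
- exact: bmeas_cst.
- exact: bR'.
by rewrite Rint_kbind.
Qed.

Definition hist_value k n (h : hist Y A n) : R :=
  \int[bel b n h]_s state_value k (s, h).

Lemma bmeas_hist_value k n : (n + k < horizon P)%N -> bmeas (@hist_value k n).
Proof.
move=> nkT; apply: (@bmeas_Rint _ _ _ _ _ (bel b n)
  (fun hs => state_value k (hs.2, hs.1))).
apply: (bmeas_comp (bmeas_state_value nkT)).
exact: measurable_fun_pair.
Qed.

Lemma hist_value0 n (h : hist Y A n) : (n < horizon P)%N ->
  hist_value 0 h = \int[bel b n h]_s cost P n (s, mu n h).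
Proof. by move=> nT; apply: eq_Rintegral => s _; rewrite state_value0. Qed.

(** Average [state_valueS] over the belief. The continuation is a function of the next state and
    observation, so the tower property turns it into a value of the next history. *)
Lemma hist_valueS k n (h : hist Y A n) : (n + k.+1 < horizon P)%N ->
  hist_value k.+1 h = \int[bel b n h]_s cost P n (s, mu n h) +
    \int[predict P (bel b n) (h, mu n h)]_z
      hist_value k (hnext h (mu n h) z.2).
Proof.
move=> nkT; have nT : (n < horizon P)%N.
  by apply: leq_ltn_trans nkT; rewrite leq_addr.
have nT' : (n.+1 < horizon P)%N.
  by apply: leq_ltn_trans nkT; rewrite addnS ltnS leq_addr.
have bJ : bmeas (@state_value k n.+1).
  by apply: bmeas_state_value; rewrite addSnnS.
pose f (z : S * Y) := state_value k (z.1, hnext h (mu n h) z.2).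
have bf : bmeas f.
  apply: (bmeas_comp bJ); apply: measurable_fun_pair => //.
  by apply: measurable_hnext => //; exact: measurable_cst.
rewrite -(Rint_predict_bel h (mu n h) nT' bf) Rint_predict//.
rewrite -(RintD (prob_kernelT (bel b n) h) (bmeas_cost_act _ nT)).
  by apply: eq_Rintegral => s _; rewrite state_valueS.
apply: (@bmeas_comp _ _ _ _ _ (fun s => (s, mu n h)) (fun sa =>
  \int[trans P n sa]_z f z)); last exact: pair2_measurable.
exact: bmeas_Rint_kernel.
Qed.

Lemma policy_valueE n (h : hist Y A n) : (n < horizon P)%N ->
  policy_value b mu h = (hist_value (horizon P - n).-1 h)%:E.
Proof.
move=> nT; have nkT : (n + (horizon P - n).-1 < horizon P)%N.
  by rewrite -ltn_subRL prednK ?subn_gt0// leqnn.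
have bR := bmeas_reward nkT.
rewrite /policy_value -(RintE (prob_kernelT (traj_given b mu _ n) h) bR).
by rewrite /traj_given Rint_kbind.
Qed.

End policy_recursion.

(** * Value functions of the abstract MDP *)

Section almost_sure_set.
Context d (T : measurableType d) (R : realType).
Variables (m : {measure set T -> \bar R}) (D : set T).
Hypotheses (m1 : m [set: T] = 1%E) (mD : measurable D) (mD1 : m D = 1%E).

Lemma Rint_full_set (f : T -> R) : bmeas f ->
  \int[m]_(x in D) f x = \int[m]_x f x.
Proof.
move=> bf; have mDC : m (~` D) = 0%E.
  rewrite -setTD measureD// ?setTI ?[X in (X < _)%E]m1 ?ltry//.
  by rewrite [X in (X - _)%E]m1 [X in (_ - X)%E]mD1 subee.
rewrite /Rintegral; congr fine.
rewrite [RHS](negligible_integral (measurableC mD) _ _ mDC)//.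
  by rewrite setTD setCK.
exact: bmeas_integrable.
Qed.

(** Used for the fiber measures [lamP] and [lamc], where bounds are known on the fiber only. *)
Lemma normr_Rint_le_on (f : T -> R) (r : R) : bmeas f ->
  (forall x, D x -> `|f x| <= r) -> `|\int[m]_x f x| <= r.
Proof.
move=> bf fr; rewrite -Rint_full_set//.
have iD g : bmeas g -> m.-integrable D (EFin \o g).
  by move=> bg; apply: (integrableS measurableT) => //; exact: bmeas_integrable.
rewrite (le_trans (le_normr_Rintegral mD (iD _ bf)))//.
have -> : r = \int[m]_(x in D) r by rewrite Rintegral_cst// mD1 mulr1.
by apply: le_Rintegral => //; apply: iD; [exact: bmeas_norm|exact: bmeas_cst].
Qed.

End almost_sure_set.

Section abstract_values.
Context (R : realType) (dS dY dA dX : measure_display)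
  (S : borelSpaceType R dS) (Y : borelSpaceType R dY)
  (A : borelSpaceType R dA) (X : borelSpaceType R dX)
  (P : pomdp S Y A) (abs : abstraction S X).

Let M := abstract_mdp P abs.
Let V := mdp_value M.

Lemma abs_costE n x a : (n < horizon P)%N ->
  abs_cost P abs n (x, a) = \int[lamc abs x]_s cost P n (s, a).
Proof.
move=> nT; rewrite /abs_cost /fiber_fun/= Rint_full_set//.
- exact: prob_kernelT.
- exact: measurable_fiber.
- exact: lamc_fiber.
- exact: bmeas_cost_act.
Qed.

Lemma bmeas_abs_cost n : (n < horizon P)%N -> bmeas (abs_cost P abs n).
Proof.
move=> nT; split; first exact: (measurable_funPT (mdp_cost M n)).
have [c cP] := (bmeas_cost nT).2; exists c => -[x a]; rewrite abs_costE//.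
apply: normr_Rint_le => //; first exact: prob_kernelT.
exact: bmeas_cost_act.
Qed.

(** A real-valued counterpart of [qvalue], which agrees with it for bounded measurable [U]. *)
Definition real_qvalue n (U : X -> R) x a : R := abs_cost P abs n (x, a) +
  (if (n.+1 < horizon P)%N then \int[abs_trans P abs n (x, a)]_x' U x' else 0).

Lemma qvalueE n U x a : bmeas U ->
  qvalue M n U x a = (real_qvalue n U x a)%:E.
Proof.
move=> bU; rewrite /qvalue /real_qvalue EFinD /=; congr (_ + _)%E.
case: ifPn => // _; rewrite RintE//.
exact: prob_kernelT.
Qed.

Lemma real_qvalue_bounded n U : (n < horizon P)%N -> bmeas U ->
  exists c : R, forall x a, `|real_qvalue n U x a| <= c.
Proof.
move=> nT bU; have [c cP] := (bmeas_abs_cost nT).2; have [u uP] := bU.2.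
exists (c + u) => x a; rewrite (le_trans (ler_normD _ _))// lerD//.
case: ifPn => _; last by rewrite normr0 (le_trans _ (uP point)).
by apply: normr_Rint_le => //; exact: prob_kernelT.
Qed.

Lemma mdp_value_rec n x : (n < horizon P)%N ->
  V n x = fine (bellman M n (V n.+1) x).
Proof. by move=> nT; rewrite /V /mdp_value/= -(subnSK nT). Qed.

Lemma bellman_fin n U x : (n < horizon P)%N -> bmeas U ->
  bellman M n U x \is a fin_num.
Proof.
move=> nT bU; have [c cP] := real_qvalue_bounded nT bU.
rewrite fin_numE; apply/andP; split; apply/eqP => B.
  have : ((- c)%:E <= bellman M n U x)%E.
    apply: le_ereal_inf_tmp => _ [a _ <-]; rewrite qvalueE// lee_fin.
    by have := cP x a; rewrite ler_norml => /andP[].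
  by rewrite B.
have : (bellman M n U x <= qvalue M n U x point)%E.
  by apply: ereal_inf_lbound; exists point.
by rewrite B qvalueE.
Qed.

Lemma mdp_value_le n x a : (n < horizon P)%N -> bmeas (V n.+1) ->
  V n x <= real_qvalue n (V n.+1) x a.
Proof.
move=> nT bV; rewrite -lee_fin mdp_value_rec// fineK ?bellman_fin//.
by rewrite -qvalueE//; apply: ereal_inf_lbound; exists a.
Qed.

Lemma mdp_value_attained n x a : bmeas (V n.+1) -> (n < horizon P)%N ->
  qvalue M n (V n.+1) x a = bellman M n (V n.+1) x ->
  V n x = real_qvalue n (V n.+1) x a.
Proof.
by move=> bV nT aopt; rewrite mdp_value_rec// -aopt qvalueE.
Qed.

Hypothesis Msel : measurable_selection M.

(** Backward induction in time. An infimum over uncountably many actions need not be measurable;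
    measurable selection provides measurability, and, as the infimum is attained, boundedness is
    inherited from [real_qvalue]. *)
Lemma bmeas_mdp_value n : bmeas (V n).
Proof.
have [k] := ubnP (horizon P - n); elim: k n => // k IHk n.
have [Tn|nT] := leqP (horizon P) n.
  move=> _; rewrite /V /mdp_value /= (eqP Tn) /=; exact: bmeas_cst.
rewrite ltnS -(subnSK nT) => /IHk bV.
have [U UE] : exists U : {mfun X >-> R}, U = V n.+1 :> (X -> R).
  by case: bV => mV _; exists (mfun_Sub (mem_set mV)); rewrite mfun_valP.
have [|pi [piopt mpi]] := Msel (V := U) nT.
  move=> _ x a; rewrite UE; apply: bmeas_integrable => //.
  exact: prob_kernelT.
rewrite UE in piopt mpi.
have VE x : V n x = real_qvalue n (V n.+1) x (pi x).
  by apply: mdp_value_attained => //; rewrite piopt.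
split.
  apply/measurable_EFinP; apply: eq_measurable_fun mpi => x _ /=.
  by rewrite VE qvalueE.
have [c cP] := real_qvalue_bounded nT bV.
by exists c => x; rewrite VE.
Qed.

End abstract_values.

(** * One step of the comparison *)

Section one_step.
Context (R : realType) (dS dY dA dX : measure_display)
  (S : borelSpaceType R dS) (Y : borelSpaceType R dY)
  (A : borelSpaceType R dA) (X : borelSpaceType R dX)
  (P : pomdp S Y A) (b : belief P) (abs : abstraction S X)
  (E : forall n, {mfun hist Y A n >-> X}) (FP Fc : nat -> R -> R).
Hypothesis FP_shape : forall n, (n.+1 < horizon P)%N ->
  concave_nondecreasing (FP n).
Hypothesis Fc_shape : forall n, (n < horizon P)%N ->
  concave_nondecreasing (Fc n).
Hypothesis FP_bound : forall n, (n.+1 < horizon P)%N ->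
  forall (s s' : S) (a : A),
  (wasserstein (trans_abs P abs n (s, a)) (trans_abs P abs n (s', a))
    <= (FP n (mdist (phi abs s) (phi abs s')))%:E)%E.
Hypothesis Fc_bound : forall n, (n < horizon P)%N ->
  forall (s s' : S) (a : A),
  `|cost P n (s, a) - cost P n (s', a)|
    <= Fc n (mdist (phi abs s) (phi abs s')).
Hypothesis est_finite : forall n, (n < horizon P)%N ->
  (est_error b abs E n < +oo)%E.

Local Notation eta n := (fine (est_error b abs E n)).

Lemma est_error_ge0 n : (0 <= est_error b abs E n)%E.
Proof.
apply: le_trans (ereal_sup_ubound _); last by exists point.
by apply: integral_ge0 => s _; rewrite lee_fin mdist_ge0.
Qed.

Lemma le_est_error n (h : hist Y A n) : (n < horizon P)%N ->
  (\int[bel b n h]_s (mdist (phi abs s) (E n h))%:E <= (eta n)%:E)%E.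
Proof.
move=> nT; rewrite fineK; last by rewrite ge0_fin_numE ?est_error_ge0// est_finite.
by apply: ereal_sup_ubound; exists h.
Qed.

(** Jensen's inequality in the form used three times below: [Fc] with factor 1 for costs, [FP] with
    factor [Lip V] for transitions, and the identity with factor [Lip V] for the next estimate. *)
Lemma est_error_Jensen n (h : hist Y A n) (F : R -> R) (L : \bar R) (g : S -> R) :
  (n < horizon P)%N -> concave_nondecreasing F -> (0 <= L)%E -> bmeas g ->
  (forall s, (g s)%:E <= L * (F (mdist (phi abs s) (E n h)))%:E)%E ->
  ((\int[bel b n h]_s g s)%:E <= L * (F (eta n))%:E)%E.
Proof.
move=> nT cF L0 bg gF; apply: (concave_Jensen (prob_kernelT (bel b n) h) cF L0
  _ _ (le_est_error h nT) bg gF); last by move=> s; exact: mdist_ge0.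
under eq_fun do rewrite metric_sym.
apply: (measurableT_comp (measurable_mdist (E n h))).
exact: (measurable_funPT (phi abs)).
Qed.

Lemma belief_cost_abs_cost n (h : hist Y A n) a : (n < horizon P)%N ->
  `|\int[bel b n h]_s cost P n (s, a) - abs_cost P abs n (E n h, a)| <=
    epsilon b abs E Fc n.
Proof.
move=> nT; have bc := bmeas_cost_act a nT.
have bel1 := prob_kernelT (bel b n) h; set x := E n h.
have bcc : bmeas (fun s => cost P n (s, a) - abs_cost P abs n (x, a)).
  by apply: bmeasB => //; exact: bmeas_cst.
have : ((\int[bel b n h]_s `|cost P n (s, a) - abs_cost P abs n (x, a)|)%:E
    <= 1 * (Fc n (eta n))%:E)%E.
  apply: est_error_Jensen => //; [exact: Fc_shape|exact: bmeas_norm|move=> s].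
  rewrite mul1e lee_fin abs_costE//.
  (* The abstract cost averages the cost over the fiber of [x]. Writing [cost P n (s, a)] as the
     average of a constant reduces the claim to states [s'] with [phi abs s' = x]. *)
  rewrite -[cost P n (s, a) in leLHS](Rint_cst (prob_kernelT (lamc abs) x)).
  rewrite -(RintB (prob_kernelT (lamc abs) x) (bmeas_cst _ _) bc).
  apply: (normr_Rint_le_on (prob_kernelT (lamc abs) x) (measurable_fiber abs x)).
  - exact: lamc_fiber.
  - by apply: bmeasB => //; exact: bmeas_cst.
  - by move=> s' /= s'x; rewrite -[X in mdist _ X]s'x; exact: Fc_bound.
rewrite mul1e lee_fin; apply: le_trans.
rewrite -[abs_cost P abs n (x, a) in leLHS](Rint_cst bel1).
by rewrite -(RintB bel1 bc (bmeas_cst _ _)); exact: normr_Rint.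
Qed.

(** The abstract transition averages [G] over the fiber of the estimate, so it suffices to compare
    [G s] with [G s'] for [s'] in that fiber. There [Rint_wasserstein] and [FP_bound] apply, and
    Jensen's inequality averages over the belief. *)
Lemma belief_trans_abs_trans n (h : hist Y A n) a (V : X -> R) :
  (n.+1 < horizon P)%N -> bmeas V ->
  (`|\int[bel b n h]_s \int[trans_abs P abs n (s, a)]_x V x -
     \int[abs_trans P abs n (E n h, a)]_x V x|%:E <=
    Lip V * (FP n (eta n))%:E)%E.
Proof.
move=> nT bV; have nT' := ltnW nT.
have bel1 := prob_kernelT (bel b n) h; set x := E n h.
pose G s := \int[trans_abs P abs n (s, a)]_x V x.
have bG : bmeas G.
  apply: (@bmeas_comp _ _ _ _ _ (fun s => (s, a)) (fun sa =>
    \int[trans_abs P abs n sa]_x V x)); last exact: pair2_measurable.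
  exact: bmeas_Rint_kernel.
have lam1 := prob_kernelT (lamP abs) x.
have bGc c : bmeas (fun s => G s - c) by apply: bmeasB => //; exact: bmeas_cst.
rewrite /abs_trans Rint_mkfiber// -/(G _); set c := \int[lamP abs x]_s _.
rewrite -[c](Rint_cst bel1) -(RintB bel1 bG (bmeas_cst _ _)).
apply: (@le_trans _ _ (\int[bel b n h]_s `|G s - c|)%:E).
  by rewrite lee_fin; exact: normr_Rint.
apply: est_error_Jensen => //; [exact: FP_shape|exact: Lip_ge0|exact: bmeas_norm|].
move=> s; have GG s' : phi abs s' = x ->
    (`|G s - G s'|%:E <= Lip V * (FP n (mdist (phi abs s) x))%:E)%E.
  move=> s'x; rewrite -[X in mdist _ X]s'x.
  apply: Rint_wasserstein => //; [exact: prob_kernelT..|exact: FP_bound].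
have := mule_ge0 (Lip_ge0 V) (_ : 0 <= (FP n (mdist (phi abs s) x))%:E)%E.
have [F0 _ _] := FP_shape nT; rewrite lee_fin F0 ?mdist_ge0// => /(_ isT).
(* An infinite bound is trivial; a finite one is uniform over the fiber and can be integrated. *)
case: (Lip V * _)%E GG => [r GG _|_ _|//]; last exact: leey.
rewrite lee_fin -[G s](Rint_cst lam1) -(RintB lam1 (bmeas_cst _ _) bG).
apply: (normr_Rint_le_on lam1 (measurable_fiber abs x)).
- exact: lamP_fiber.
- by apply: bmeasB => //; exact: bmeas_cst.
- by move=> s' /= /GG; rewrite lee_fin.
Qed.

Lemma bmeas_estimate n (h : hist Y A n) a (V : X -> R) : bmeas V ->
  bmeas (fun z : S * Y => V (E n.+1 (hnext h a z.2))).
Proof.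
move=> bV; apply: (bmeas_comp bV).
apply: (measurableT_comp (measurable_funPT (E n.+1))).
by apply: measurable_hnext => //; exact: measurable_cst.
Qed.

(** Under the predicted joint law, [V] is evaluated at the next estimate on one side and at the true
    next abstract state on the other. Given the next history, their mean difference is at most
    [Lip V] times the estimation error at time [n.+1]. *)
Lemma next_estimate_belief n (h : hist Y A n) a (V : X -> R) :
  (n.+1 < horizon P)%N -> bmeas V ->
  (`|\int[predict P (bel b n) (h, a)]_z V (E n.+1 (hnext h a z.2)) -
     \int[bel b n h]_s \int[trans_abs P abs n (s, a)]_x V x|%:E <=
    Lip V * (eta n.+1)%:E)%E.
Proof.
move=> nT bV; have pred1 := prob_kernelT (predict P (bel b n)) (h, a).
have mphi := measurable_funPT (phi abs).
have bVphi1 : bmeas (fun s => V (phi abs s)) by exact: (bmeas_comp bV).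
have bVphi : bmeas (fun z : S * Y => V (phi abs z.1)).
  by apply: (bmeas_comp bVphi1); exact: measurable_fst.
have bVE := bmeas_estimate h a bV.
have -> : \int[bel b n h]_s \int[trans_abs P abs n (s, a)]_x V x =
    \int[predict P (bel b n) (h, a)]_z V (phi abs z.1).
  rewrite Rint_predict//; apply: eq_Rintegral => s _.
  by rewrite /trans_abs Rint_mkpush// /trans_state Rint_mkpush.
rewrite -(RintB pred1 bVE bVphi) (Rint_predict_bel b h a nT (bmeasB bVE bVphi))/=.
have err z : (`|\int[bel b n.+1 (hnext h a z)]_s
    (V (E n.+1 (hnext h a z)) - V (phi abs s))|%:E <= Lip V * (eta n.+1)%:E)%E.
  have bg : bmeas (fun s => V (E n.+1 (hnext h a z)) - V (phi abs s)).
    by apply: bmeasB => //; exact: bmeas_cst.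
  apply: (@le_trans _ _ (\int[bel b n.+1 (hnext h a z)]_s
      `|V (E n.+1 (hnext h a z)) - V (phi abs s)|)%:E).
    by rewrite lee_fin; apply: normr_Rint => //; exact: prob_kernelT.
  apply: (est_error_Jensen nT (@concave_nondecreasing_id R) (Lip_ge0 V)).
    exact: bmeas_norm.
  by move=> s; rewrite metric_sym; exact: le_Lip.
have := mule_ge0 (Lip_ge0 V) (_ : 0 <= (eta n.+1)%:E)%E.
rewrite lee_fin fine_ge0 ?est_error_ge0// => /(_ isT).
case: (Lip V * _)%E err => [r err _|_ _|//]; last exact: leey.
rewrite lee_fin; apply: normr_Rint_le => //; last first.
  by move=> z; rewrite -lee_fin; exact: err.
have mh : measurable_fun [set: S * Y] (fun z => hnext h a z.2).
  by apply: measurable_hnext => //; exact: measurable_cst.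
apply: (bmeas_Rint (kpre (bel b n.+1) mh) (f := fun zs =>
  V (E n.+1 (hnext h a zs.1.2)) - V (phi abs zs.2))).
apply: bmeasB.
  by apply: (bmeas_comp bVE); exact: measurable_fst.
by apply: (bmeas_comp bVphi1); exact: measurable_snd.
Qed.

Lemma epsilon_ge0 n : (n < horizon P)%N -> 0 <= epsilon b abs E Fc n.
Proof.
move=> nT; have [F0 _ _] := Fc_shape nT.
by apply: F0; rewrite fine_ge0// est_error_ge0.
Qed.

Lemma delta_Lip_ge0 n (V : X -> R) : (n.+1 < horizon P)%N ->
  (0 <= (delta b abs E FP n)%:E * Lip V)%E.
Proof.
move=> nT; have [F0 _ _] := FP_shape nT.
rewrite mule_ge0 ?Lip_ge0// lee_fin addr_ge0 ?F0//;
  by rewrite fine_ge0// est_error_ge0.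
Qed.

Local Notation V := (mdp_value (abstract_mdp P abs)).
Local Notation alpha n := (alpha b abs E FP Fc n).

Lemma alphaE n : (n < horizon P)%N -> alpha n = ((epsilon b abs E Fc n)%:E +
  if (n.+1 < horizon P)%N
  then (delta b abs E FP n)%:E * Lip (V n.+1) + alpha n.+1 else 0)%E.
Proof.
move=> nT; rewrite /Defs.alpha; congr (_ + _)%E; case: ifPn => nT'.
  by rewrite big_ltn ?addeA// -ltnS (ltn_predK nT).
by rewrite big_geq// -ltnS (ltn_predK nT) leqNgt.
Qed.

Lemma alpha_ge0 n : (n < horizon P)%N -> (0 <= alpha n)%E.
Proof.
move=> nT; apply: adde_ge0; first by rewrite lee_fin epsilon_ge0.
rewrite big_seq; apply: sume_ge0 => m; rewrite mem_index_iota => /andP[_ mT].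
have mT' : (m.+1 < horizon P)%N by rewrite -(ltn_predK nT) ltnS.
by apply: adde_ge0; rewrite ?delta_Lip_ge0// lee_fin epsilon_ge0.
Qed.

Lemma last_step n (h : hist Y A n) a : n.+1 = horizon P ->
  `|\int[bel b n h]_s cost P n (s, a) -
    real_qvalue P abs n (V n.+1) (E n h) a| <= epsilon b abs E Fc n.
Proof.
move=> nT; rewrite /real_qvalue nT ltnn addr0.
by apply: belief_cost_abs_cost; rewrite -nT.
Qed.

Lemma one_step n (h : hist Y A n) a : (n.+1 < horizon P)%N -> bmeas (V n.+1) ->
  (`|\int[bel b n h]_s cost P n (s, a) +
     \int[predict P (bel b n) (h, a)]_z V n.+1 (E n.+1 (hnext h a z.2)) -
     real_qvalue P abs n (V n.+1) (E n h) a|%:E <=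
   (epsilon b abs E Fc n)%:E + (delta b abs E FP n)%:E * Lip (V n.+1))%E.
Proof.
move=> nT bV; rewrite /real_qvalue nT.
have := belief_cost_abs_cost h a (ltnW nT).
have := belief_trans_abs_trans h a nT bV.
have := next_estimate_belief h a nT bV.
set c := \int[bel b n h]_s cost P n (s, a); set p := \int[predict P _ _]_z _.
set q := \int[bel b n h]_s _; set r := \int[abs_trans P _ _ _]_x _.
set k := abs_cost _ _ _ _ => pq qr ck.
have : (`|p - r|%:E <= (delta b abs E FP n)%:E * Lip (V n.+1))%E.
  (* Pass through [q], the mean of [V n.+1] at the true next abstract state: the first difference is
     the next estimation error, the second the abstraction error of the transition. *)
  apply: (@le_trans _ _ (`|p - q|%:E + `|q - r|%:E)%E).
    by rewrite -EFinD lee_fin (_ : p - r = (p - q) + (q - r)) ?ler_normD//; ring.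
  have [F0 _ _] := FP_shape nT.
  have eta_ge0 m : 0 <= eta m by rewrite fine_ge0// est_error_ge0.
  have -> : ((delta b abs E FP n)%:E * Lip (V n.+1) =
      Lip (V n.+1) * (eta n.+1)%:E + Lip (V n.+1) * (FP n (eta n))%:E)%E.
    by rewrite muleC /delta addrC EFinD ge0_muleDr// lee_fin// F0.
  exact: leeD.
have eps0 := epsilon_ge0 (ltnW nT).
have := delta_Lip_ge0 (V n.+1) nT.
case: ((delta _ _ _ _ _)%:E * _)%E => [u _| |]; [|by move=> _ _; exact: leey|by []].
rewrite -EFinD !lee_fin => pru.
have := ler_normD (c - k) (p - r).
by rewrite (_ : c - k + (p - r) = c + p - (k + r)); [lra|ring].
Qed.

(** All summands are nonnegative, so finiteness of the total passes to each of them; the inductions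
    below can then be carried out in [R]. *)
Lemma alpha_fin_next n r : (n.+1 < horizon P)%N -> alpha n = r%:E ->
  exists u v, [/\ ((delta b abs E FP n)%:E * Lip (V n.+1) = u%:E)%E,
    alpha n.+1 = v%:E & epsilon b abs E Fc n + (u + v) = r].
Proof.
move=> nT; rewrite alphaE ?(ltnW nT)// nT.
have := delta_Lip_ge0 (V n.+1) nT; have := alpha_ge0 nT.
case: (alpha n.+1) => [v| |] //; case: (_ * _)%E => [u| |] // _ _.
by rewrite -!EFinD => -[<-]; exists u, v.
Qed.

(** * Comparison with the values of a policy by backward induction *)

Hypothesis Msel : measurable_selection (abstract_mdp P abs).

Section policy.
Variable mu : policy Y A.

Let gap k n (h : hist Y A n) := hist_value b mu k h - V n (E n h).

Let bmeas_gap_next k n (h : hist Y A n) a : (n + k.+1 < horizon P)%N ->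
  bmeas (fun z : S * Y => gap k (hnext h a z.2)).
Proof.
move=> nkT; apply: bmeasB.
  apply: (bmeas_comp (bmeas_hist_value b mu (k := k) (n := n.+1) _)).
    by rewrite addSnnS.
  by apply: measurable_hnext => //; exact: measurable_cst.
exact: bmeas_estimate (bmeas_mdp_value Msel n.+1).
Qed.

(** Subtracting the expected gap replaces the continuation value of the policy by [V n.+1] at the
    next estimate, which is the situation of [one_step]. *)
Let hist_value_qvalue k n (h : hist Y A n) (u : R) :
  (n + k.+1 < horizon P)%N ->
  ((delta b abs E FP n)%:E * Lip (V n.+1) = u%:E)%E ->
  `|hist_value b mu k.+1 h - real_qvalue P abs n (V n.+1) (E n h) (mu n h) -
    \int[predict P (bel b n) (h, mu n h)]_z gap k (hnext h (mu n h) z.2)|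
  <= epsilon b abs E Fc n + u.
Proof.
move=> nkT uE; have nT : (n.+1 < horizon P)%N.
  by apply: leq_ltn_trans nkT; rewrite addnS ltnS leq_addr.
have bV := bmeas_mdp_value Msel n.+1.
have := one_step h (mu n h) nT bV; rewrite uE -EFinD lee_fin; apply: le_trans.
rewrite hist_valueS//.
have bW : bmeas (fun z : S * Y => hist_value b mu k (hnext h (mu n h) z.2)).
  apply: (bmeas_comp (bmeas_hist_value b mu (k := k) (n := n.+1) _)).
    by rewrite addSnnS.
  by apply: measurable_hnext => //; exact: measurable_cst.
rewrite (RintB (prob_kernelT (predict P (bel b n)) _) bW (bmeas_estimate _ _ bV)).
rewrite le_eqVlt; apply/orP; left; apply/eqP; congr (`|_|); ring.
Qed.

(** The action of [mu] is one candidate in the abstract minimum, so [V n] is at most its abstract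
    action value. The induction hypothesis bounds the next gap below by [- v] for every observation,
    hence in the mean. *)
Lemma mdp_value_le_hist_value k n (h : hist Y A n) (r : R) :
  (n + k.+1)%N = horizon P -> alpha n = r%:E ->
  V n (E n h) <= hist_value b mu k h + r.
Proof.
elim: k n h r => [|k IHk] n h r nkT.
  have nT : n.+1 = horizon P by rewrite -nkT addn1.
  have nT' : (n < horizon P)%N by rewrite -nT.
  rewrite alphaE// nT ltnn adde0 => -[<-]; rewrite hist_value0//.
  have := last_step h (mu n h) nT.
  have := mdp_value_le (E n h) (mu n h) nT' (bmeas_mdp_value Msel n.+1).
  by rewrite ler_norml => ? /andP[? ?]; lra.
have nT : (n.+1 < horizon P)%N by rewrite -nkT !addnS !ltnS leq_addr.
have nkT' : (n + k.+1 < horizon P)%N by rewrite -nkT ltn_add2l.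
move=> /(alpha_fin_next nT)[u [v [uE vE <-]]].
have := hist_value_qvalue h nkT' uE; rewrite ler_norml => /andP[+ _].
have := mdp_value_le (E n h) (mu n h) (ltnW nT) (bmeas_mdp_value Msel n.+1).
have : - v <= \int[predict P (bel b n) (h, mu n h)]_z
    gap k (hnext h (mu n h) z.2).
  have p1 := prob_kernelT (predict P (bel b n)) (h, mu n h).
  rewrite -[- v](Rint_cst p1); apply: le_Rint => //; first exact: bmeas_cst.
    exact: bmeas_gap_next.
  move=> z; have := IHk n.+1 (hnext h (mu n h) z.2) v.
  by rewrite addSnnS => /(_ nkT vE); rewrite /gap; lra.
lra.
Qed.

(** The reverse estimate needs the action of [mu] to attain the abstract minimum at the estimate;
    the gap is then bounded above by [v] in the same way. *)
Lemma hist_value_le_mdp_value k n (h : hist Y A n) (r : R) :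
  (forall m (h' : hist Y A m), (m < horizon P)%N ->
    V m (E m h') = real_qvalue P abs m (V m.+1) (E m h') (mu m h')) ->
  (n + k.+1)%N = horizon P -> alpha n = r%:E ->
  hist_value b mu k h <= V n (E n h) + r.
Proof.
move=> greedy; elim: k n h r => [|k IHk] n h r nkT.
  have nT : n.+1 = horizon P by rewrite -nkT addn1.
  have nT' : (n < horizon P)%N by rewrite -nT.
  rewrite alphaE// nT ltnn adde0 => -[<-]; rewrite hist_value0// greedy//.
  have := last_step h (mu n h) nT.
  by rewrite ler_norml => /andP[? ?]; lra.
have nT : (n.+1 < horizon P)%N by rewrite -nkT !addnS !ltnS leq_addr.
have nkT' : (n + k.+1 < horizon P)%N by rewrite -nkT ltn_add2l.
move=> /(alpha_fin_next nT)[u [v [uE vE <-]]].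
have := hist_value_qvalue h nkT' uE; rewrite ler_norml => /andP[_].
rewrite greedy ?(ltnW nT)//.
have : \int[predict P (bel b n) (h, mu n h)]_z
    gap k (hnext h (mu n h) z.2) <= v.
  have p1 := prob_kernelT (predict P (bel b n)) (h, mu n h).
  rewrite -[leRHS](Rint_cst p1); apply: le_Rint => //; last 1 first.
  - move=> z; have := IHk n.+1 (hnext h (mu n h) z.2) v.
    by rewrite addSnnS => /(_ nkT vE); rewrite /gap; lra.
  - exact: bmeas_gap_next.
  - exact: bmeas_cst.
lra.
Qed.

End policy.

End one_step.

(** * Loss of the certainty equivalent policy *)

Local Open Scope ereal_scope.

Theorem theorem2 (R : realType) (dS dY dA dX : measure_display)
    (S : borelSpaceType R dS) (Y : borelSpaceType R dY)
    (A : borelSpaceType R dA) (X : borelSpaceType R dX)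
    (P : pomdp S Y A) (b : belief P) (abs : abstraction S X)
    (E : forall n, {mfun hist Y A n >-> X})
    (FP Fc : nat -> R -> R) (pi : nat -> {mfun X >-> A})
    (Msel : measurable_selection (abstract_mdp P abs))
    (FP_shape : forall n, (n.+1 < horizon P)%N -> concave_nondecreasing (FP n))
    (Fc_shape : forall n, (n < horizon P)%N -> concave_nondecreasing (Fc n))
    (FP_bound : forall n, (n.+1 < horizon P)%N -> forall (s s' : S) (a : A),
      wasserstein (trans_abs P abs n (s, a)) (trans_abs P abs n (s', a))
        <= (FP n (mdist (phi abs s) (phi abs s')))%:E)
    (Fc_bound : forall n, (n < horizon P)%N -> forall (s s' : S) (a : A),
      (`|cost P n (s, a) - cost P n (s', a)|
        <= Fc n (mdist (phi abs s) (phi abs s')))%R)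
    (est_finite : forall n, (n < horizon P)%N -> est_error b abs E n < +oo)
    (pi_optimal : optimal_policy (abstract_mdp P abs) pi) :
  forall n, (n < horizon P)%N -> forall h : hist Y A n,
    policy_value b (ce_policy E pi) h - optimal_value b h
      <= 2%:E * alpha b abs E FP Fc n.
Proof.
move=> n nT h; have nkT : (n + (horizon P - n).-1.+1)%N = horizon P.
  by rewrite prednK ?subn_gt0// subnKC// ltnW.
have := alpha_ge0 b abs E FP_shape Fc_shape nT.
(* If [alpha] is infinite, so is the right-hand side. *)
case alphaE : (alpha b abs E FP Fc n) => [r| |]//; last first.
  by rewrite gt0_muley ?leey// lte_fin.
move=> _; set V := mdp_value (abstract_mdp P abs) n (E n h).
have opt_ge : (V - r)%:E <= optimal_value b h.
  apply: le_ereal_inf_tmp => _ [mu _ <-]; rewrite policy_valueE// lee_fin lerBlDr.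
  exact: (mdp_value_le_hist_value FP_shape Fc_shape FP_bound Fc_bound).
rewrite policy_valueE//.
set W := hist_value _ _ _ _.
have WV : (W <= V + r)%R.
  apply: (hist_value_le_mdp_value FP_shape Fc_shape FP_bound Fc_bound) => //.
  move=> m h' mT; apply: mdp_value_attained => //; first exact: bmeas_mdp_value.
  exact: pi_optimal.
(* Both values are compared with the same [V], each with error [r], whence the factor 2. *)
apply: (@le_trans _ _ (W%:E - (V - r)%:E)); first by rewrite leeB.
by rewrite -EFinB -EFinM lee_fin; lra.
Qed.
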